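(* (i) If $\omega$ is a superharmonic weight and $f\in\mathcal D_\omega$, then $\|\sigma_n(f)-f\|_{\mathcal D_\omega}\to0$ as $n\to\infty$. (ii) There exist a superharmonic weight $\omega$ and a function $f\in\mathcal D_\omega$ such that $\|s_n(f)-f\|_{\mathcal D_\omega}\not\to0$ as $n\to\infty$.
   Context: $\mathbb D$ is the open unit disk, $dA$ is normalized area measure on $\mathbb D$. A superharmonic weight is a positive superharmonic function $\omega$ on $\mathbb D$. For $f$ holomorphic on $\mathbb D$, $\mathcal D_\omega(f):=\int_{\mathbb D}|f'(z)|^2\omega(z)\,dA(z)$, $\mathcal D_\omega$ is the space of holomorphic $f$ on $\mathbb D$ with $\mathcal D_\omega(f)<\infty$, with norm $\|f\|^2_{\mathcal D_\omega}=|f(0)|^2+\mathcal D_\omega(f)$. For $f(z)=\sum_{k\ge0}a_kz^k$, $s_n(f)(z):=\sum_{k=0}^na_kz^k$ and $\sigma_n(f):=\frac1{n+1}\sum_{k=0}^ns_k(f)$. *)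

(* Defs.v *)
From HB Require Import structures.
From mathcomp Require Import all_boot all_order all_algebra.
From mathcomp Require Import all_classical all_reals all_analysis.
From mathcomp Require Import complex.
Set Implicit Arguments. Unset Strict Implicit. Unset Printing Implicit Defensive.
Import Order.TTheory GRing.Theory Num.Theory.
Import numFieldNormedType.Exports.
Local Open Scope classical_set_scope.
Local Open Scope ring_scope.

Section Defs.
Variable R : realType.
Local Notation C := (R[i]).

Definition cabs (z : C) : R := Normc.normc z.

Definition disk : set C := [set z | cabs z < 1].

Definition cseries_cvg (u : nat -> C) : Prop :=
  cvg (series (fun k => @complex.Re R (u k)) @ \oo) /\ cvg (series (fun k => @complex.Im R (u k)) @ \oo).
Definition csum (u : nat -> C) : C :=
  Complex (limn (series (fun k => @complex.Re R (u k)))) (limn (series (fun k => @complex.Im R (u k)))).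

(* A holomorphic function on the disk is represented by its Taylor coefficients
   a = (a_k), f(z) = sum_k a_k z^k, the series converging on the whole disk. *)
Definition holo_disk (a : nat -> C) : Prop :=
  forall z, disk z -> cseries_cvg (fun k => a k * z ^+ k).

Definition peval (a : nat -> C) (z : C) : C := csum (fun k => a k * z ^+ k).

Definition pderiv (a : nat -> C) : nat -> C := fun k => (k.+1)%:R * a k.+1.

Definition s_ (n : nat) (a : nat -> C) : nat -> C :=
  fun k => if (k <= n)%N then a k else 0.
Definition sigma_ (n : nat) (a : nat -> C) : nat -> C :=
  fun k => (n.+1%:R)^-1 * \sum_(j < n.+1) s_ j a k.

Definition csub (a b : nat -> C) : nat -> C := fun k => a k - b k.

Definition area_int (g : C -> \bar R) : \bar R :=
  ((pi : R)^-1)%:E *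
  (\int[(@lebesgue_measure R \x @lebesgue_measure R)%E]_(p in
       [set p : R * R | Complex p.1 p.2 \in disk]) g (Complex p.1 p.2))%E.

Definition Dint (omega : C -> \bar R) (a : nat -> C) : \bar R :=
  area_int (fun z => ((cabs (peval (pderiv a) z)) ^+ 2)%:E * omega z)%E.

Definition Dnorm2 (omega : C -> \bar R) (a : nat -> C) : \bar R :=
  (((cabs (peval a 0)) ^+ 2)%:E + Dint omega a)%E.

Definition circle_mean (omega : C -> \bar R) (z0 : C) (r : R) : \bar R :=
  ((2 * pi : R)^-1)%:E *
  (\int[@lebesgue_measure R]_(t in [set` `[0%R, (2 * pi)%R]])
      omega (z0 + Complex (r * cos t) (r * sin t))%R)%E.

Definition superharmonic_disk (omega : C -> \bar R) : Prop :=
  (forall z, disk z -> omega z != -oo%E) /\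
  (forall z, disk z -> forall c : R, (c%:E < omega z)%E ->
     exists2 d : R, 0 < d & forall w, disk w -> cabs (w - z) < d -> (c%:E < omega w)%E) /\
  (exists z, disk z /\ omega z != +oo%E) /\
  (forall z0 (r : R), 0 < r -> cabs z0 + r < 1 -> (circle_mean omega z0 r <= omega z0)%E).

Definition superharmonic_weight (omega : C -> \bar R) : Prop :=
  superharmonic_disk omega /\ (forall z, disk z -> (0 < omega z)%E).

Definition in_Dw (omega : C -> \bar R) (a : nat -> C) : Prop :=
  holo_disk a /\ (Dint omega a < +oo)%E.

End Defs.

(* Main.v *)
Require Import Defs.
From HB Require Import structures.
From mathcomp Require Import all_boot all_order all_algebra.
From mathcomp Require Import all_classical all_reals all_analysis.
From mathcomp Require Import measurable_realfun complex.
From mathcomp Require Import ring lra zify.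
Set Implicit Arguments. Unset Strict Implicit. Unset Printing Implicit Defensive.
Import Order.TTheory GRing.Theory Num.Theory.
Import numFieldNormedType.Exports.
Local Open Scope classical_set_scope.
Local Open Scope ring_scope.

(** (i) The Fejer means contract: [D_omega (sigma_n f) <= D_omega f].  With the
    pointwise convergence [(sigma_n f)' -> f'], Fatou's lemma and the
    parallelogram law, this gives norm convergence.

    For the contraction let [p] be a polynomial, [|z| < rho], [s = rho^2] and
    let [t_m(z)] be the tails [sum_(k >= m) p_k z^(k-m)].  The Green potential
    of [|p'|^2] in the disk of radius [rho] is, by the local Douglas formula,
    [U_p(z) = (s - |z|^2) sum_m s^m |t_(m+1)(z)|^2 = Re Q(z) - |p(z)|^2] with
    [Q] a polynomial, and a telescoping inequality shows that it decreases when
    [p] is replaced by [sigma_n p].  A nonnegative difference of potentials is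
    paired with the superharmonic weight: if [v >= 0] is supported in a compact
    part of the disk, Tonelli's theorem and the super-mean value property give
    [int omega M_r v <= int omega v], where [M_r] is the mean over circles of
    radius [r].  This replaces the Riesz decomposition of [omega].  Truncating
    [omega] by constants, which preserves superharmonicity, removes all
    integrability problems.

    (ii) Take for [omega] the Poisson kernel of the boundary point [1] and
    [f = (z - 1) g] with [g = sum_j 2^-j z^(4^j)].  If the partial sums
    converged, then the norms of [a_n z^n] would tend to [0]; but the square of
    that norm is of order [n |a_n|^2], which is [1] for [n = 4^j]. *)

(** With a Riesz measure for the weight, the contraction would reduce to comparing two potentials.
    Here [-Delta] is replaced by the quotient [(1 - M_r) / r^2] at one small radius: Parseval on
    circles evaluates the mean of [Re Q - |p|^2] exactly, with second-order term [- r^2 |p'|^2]. The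
    obstacle is that the difference of potentials is known to be nonnegative only for [|z|^2 <= s],
    while the averaged function must be nonnegative and compactly supported. Adding
    [delta (s - |z|^2)] makes it strictly positive inside; subtracting [eps] makes the cut-off
    harmless on a thin collar outside. The price, from [delta] and from the Taylor remainder, is an
    arbitrary [eta]. In (ii) frequencies and coefficients are balanced: [n |a_n|^2 = 1] at
    [n = 4^j], yet [g' = O((1 - |z|)^(-1/2))]. The factor [z - 1] cancels the pole of the kernel
    [P], since [|1 - z|^2 P(z) / (1 - |z|) = 1 + |z|]; hence [|f'|^2 P] is at most a multiple of
    [P + 1]. *)

Section SquaredModulus.
Variable R : realType.
Local Notation C := (R[i]).
Local Notation Re := (@complex.Re R).
Local Notation Im := (@complex.Im R).
Implicit Types x y z : C.

(** A polynomial in the two coordinates, without a square root, so that identities and estimates are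
    accessible to [ring] and [lra]. *)
Definition sqn z : R := Re z ^+ 2 + Im z ^+ 2.

Lemma sqn_ge0 z : 0 <= sqn z.
Proof. by rewrite addr_ge0 ?sqr_ge0. Qed.

Lemma cabsE z : cabs z = Num.sqrt (sqn z).
Proof. by case: z. Qed.

Lemma sqr_cabs z : cabs z ^+ 2 = sqn z.
Proof. by rewrite cabsE sqr_sqrtr// sqn_ge0. Qed.

Lemma cabs_ge0 z : 0 <= cabs z.
Proof. by rewrite cabsE sqrtr_ge0. Qed.

Lemma cabsM x y : cabs (x * y) = cabs x * cabs y.
Proof. exact: Normc.normcM. Qed.

Lemma cabsD x y : cabs (x + y) <= cabs x + cabs y.
Proof. exact: le_normcD. Qed.

Lemma cabsN x : cabs (- x) = cabs x.
Proof. exact: normcN. Qed.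

Lemma cabsB x y : cabs (x - y) <= cabs x + cabs y.
Proof. by rewrite -[cabs y]cabsN cabsD. Qed.

Lemma cabs0 : cabs (0 : C) = 0.
Proof. exact: Normc.normc0. Qed.

Lemma cabs1 : cabs (1 : C) = 1.
Proof. exact: Normc.normc1. Qed.

Lemma cabsX z n : cabs (z ^+ n) = cabs z ^+ n.
Proof. by elim: n => [|n IH]; rewrite ?expr0 ?cabs1// !exprS cabsM IH. Qed.

Lemma cabs_sum (I : Type) (s : seq I) (P : pred I) (F : I -> C) :
  cabs (\sum_(i <- s | P i) F i) <= \sum_(i <- s | P i) cabs (F i).
Proof.
elim/big_ind2 : _ => [|x a y b xa yb|//]; first by rewrite cabs0.
by rewrite (le_trans (cabsD _ _))// lerD.
Qed.

Lemma cabs_real (x : R) : cabs (Complex x 0) = `|x|.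
Proof. by rewrite cabsE /sqn/= expr0n/= addr0 sqrtr_sqr. Qed.

Lemma sqnM x y : sqn (x * y) = sqn x * sqn y.
Proof. by rewrite -!sqr_cabs cabsM exprMn. Qed.

Lemma sqnX z n : sqn (z ^+ n) = sqn z ^+ n.
Proof. by rewrite -!sqr_cabs cabsX -!exprM mulnC. Qed.

Lemma sqnN x : sqn (- x) = sqn x.
Proof. by rewrite -!sqr_cabs cabsN. Qed.

Lemma sqn0 : sqn 0 = 0.
Proof. by rewrite /sqn /= expr0n/= addr0. Qed.

Lemma sqnDB x y : sqn (x + y) + sqn (x - y) = 2 * sqn x + 2 * sqn y.
Proof. by case: x => a b; case: y => c d; rewrite /sqn/=; ring. Qed.

Lemma sqnD_le x y : sqn (x + y) <= 2 * sqn x + 2 * sqn y.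
Proof. by rewrite -sqnDB lerDl sqn_ge0. Qed.

Lemma ReD x y : Re (x + y) = Re x + Re y.
Proof. by case: x y => [? ?] [? ?]. Qed.

Lemma ImD x y : Im (x + y) = Im x + Im y.
Proof. by case: x y => [? ?] [? ?]. Qed.

Lemma ReB x y : Re (x - y) = Re x - Re y.
Proof. by case: x y => [? ?] [? ?]. Qed.

Lemma ImB x y : Im (x - y) = Im x - Im y.
Proof. by case: x y => [? ?] [? ?]. Qed.

Lemma Re_sum (I : Type) (s : seq I) (P : pred I) (F : I -> C) :
  Re (\sum_(i <- s | P i) F i) = \sum_(i <- s | P i) Re (F i).
Proof. by elim/big_rec2 : _ => // i x y _ <-; rewrite ReD. Qed.

Lemma Im_sum (I : Type) (s : seq I) (P : pred I) (F : I -> C) :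
  Im (\sum_(i <- s | P i) F i) = \sum_(i <- s | P i) Im (F i).
Proof. by elim/big_rec2 : _ => // i x y _ <-; rewrite ImD. Qed.

Lemma natrC (n : nat) : n%:R = Complex n%:R 0 :> C.
Proof. exact/esym/(rmorph_nat (real_complex R)). Qed.

Lemma sqn_natr (n : nat) : sqn (n%:R) = n%:R ^+ 2.
Proof. by rewrite natrC /sqn/= expr0n/= addr0. Qed.

Lemma cabs_natr (n : nat) : cabs (n%:R : C) = n%:R.
Proof. by rewrite natrC cabs_real normr_nat. Qed.

Lemma normRe_le z : `|Re z| <= cabs z.
Proof.
rewrite cabsE -sqrtr_sqr ler_wsqrtr//.
by rewrite /sqn lerDl sqr_ge0.
Qed.

Lemma normIm_le z : `|Im z| <= cabs z.
Proof.
rewrite cabsE -sqrtr_sqr ler_wsqrtr//.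
by rewrite /sqn lerDr sqr_ge0.
Qed.

Lemma cabs_lt z (r : R) : 0 <= r -> (cabs z < r) = (sqn z < r ^+ 2).
Proof. by move=> r0; rewrite -sqr_cabs ltr_pXn2r// nnegrE ?cabs_ge0. Qed.

Lemma cabs_le z (r : R) : 0 <= r -> (cabs z <= r) = (sqn z <= r ^+ 2).
Proof. by move=> r0; rewrite -sqr_cabs ler_pXn2r// nnegrE ?cabs_ge0. Qed.

End SquaredModulus.

(** * Fejer means decrease the tail energy *)

Section FejerTails.
Variable R : realType.
Local Notation C := (R[i]).
Local Notation Re := (@complex.Re R).
Local Notation Im := (@complex.Im R).

(* The discrete Legendre operator [n(n+1) - j(j+1)] has the ground state [j+1];
   completing the square against it makes the defect telescope. *)
Lemma fejer_square (n j : R) (v x y : C) : 0 < j -> j <= n ->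
  y = Complex j 0 * v - Complex (j + 1) 0 * x ->
  sqn y + n * (n + 1) * (sqn v / (j + 1) - sqn x / j) <=
  n * (n + 1) * sqn (v - x).
Proof.
move=> j0 jn yE.
have -> : n * (n + 1) * sqn (v - x) =
  sqn y + n * (n + 1) * (sqn v / (j + 1) - sqn x / j) +
  (n * (n + 1) - j * (j + 1)) / (j * (j + 1)) * sqn y.
  rewrite yE; case: v x {y yE} => [a b] [c d]; rewrite /sqn /=; field.
  by rewrite !gt_eqF//; lra.
rewrite lerDl mulr_ge0 ?sqn_ge0// divr_ge0//; nra.
Qed.

(** Here [d j] stands for a tail of [p] and [y j] for [n + 1] times the same tail of its Fejer mean,
    listed backwards. [fejer_square] with [x = z * v j] controls each summand, and the terms
    [sqn (v j) / (j + 1)] telescope because [sqn z <= s]. *)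
Lemma fejer_telescope (d v y : nat -> C) (z : C) (s : R) (n : nat) :
  sqn z <= s ->
  v 0%N = d 0%N -> (forall j, v j.+1 = d j.+1 + z * v j) ->
  y 0%N = 0 ->
  (forall j, (j < n)%N ->
    y j.+1 = (j.+1)%:R * (d j.+1 - z * d j) + z * y j) ->
  \sum_(j < n.+1) s ^+ (n - j) * sqn (y j) <=
  n%:R * n.+1%:R * \sum_(j < n.+1) s ^+ (n - j) * sqn (d j).
Proof.
move=> zs v0 vS y0 yS.
have s0 : 0 <= s by apply: le_trans zs; exact: sqn_ge0.
(* Solving the recursion for [y] in terms of [v] gives the form [j v - (j + 1) x] that
   [fejer_square] requires. *)
have yE j : (j < n)%N -> y j.+1 = j.+1%:R * v j.+1 - j.+2%:R * (z * v j).
  elim: j => [n0|j IH jn]; first by rewrite yS// y0 vS v0 -[2%:R]natr1; ring.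
  rewrite yS// IH 1?ltnW// !vS -[j.+3%:R]natr1 -[j.+2%:R]natr1.
  ring.
(* The induction keeps the boundary term of the telescoping sum on the left; it is nonnegative and
   is dropped at [J = n]. *)
suff H J : (J <= n)%N ->
  \sum_(j < J.+1) s ^+ (n - j) * sqn (y j) +
     n%:R * n.+1%:R * (s ^+ (n - J) * (sqn (v J) / J.+1%:R)) <=
  n%:R * n.+1%:R * \sum_(j < J.+1) s ^+ (n - j) * sqn (d j).
  apply: le_trans (H n (leqnn n)); rewrite lerDl.
  by rewrite !mulr_ge0 ?exprn_ge0 ?divr_ge0 ?sqn_ge0.
elim: J => [_|J IH Jn].
  by rewrite !big_ord_recr !big_ord0 /= y0 sqn0 mulr0 !add0r v0 divr1.
have AB := IH (ltnW Jn).
rewrite big_ord_recr [in leRHS]big_ord_recr/=.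
set A := (\sum_(_ < _) _) in AB *; set B := (\sum_(_ < _) _) in AB *.
have := @fejer_square n%:R J.+1%:R (v J.+1) (z * v J) (y J.+1) _ _.
rewrite ltr0n ler_nat => /(_ isT Jn) /=.
have -> : Complex J.+1%:R 0 * v J.+1 - Complex (J.+1%:R + 1) 0 * (z * v J) =
          y J.+1 by rewrite yE// !natrC natr1.
move=> /(_ erefl).
have -> : v J.+1 - z * v J = d J.+1 by rewrite vS addrK.
rewrite !natr1 => H.
have {}H : s ^+ (n - J.+1) * (sqn (y J.+1) +
      n%:R * n.+1%:R * (sqn (v J.+1) / J.+2%:R - sqn (z * v J) / J.+1%:R)) <=
    s ^+ (n - J.+1) * (n%:R * n.+1%:R * sqn (d J.+1)).
  by rewrite ler_wpM2l// exprn_ge0.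
have sE : s ^+ (n - J) = s ^+ (n - J.+1) * s by rewrite -exprSr -subSn.
have vz : s ^+ (n - J.+1) * (n%:R * n.+1%:R * (sqn (z * v J) / J.+1%:R)) <=
   n%:R * n.+1%:R * (s ^+ (n - J) * (sqn (v J) / J.+1%:R)).
  rewrite mulrCA ler_wpM2l ?mulr_ge0// sE -mulrA ler_wpM2l ?exprn_ge0//.
  by rewrite mulrA ler_wpM2r ?invr_ge0// sqnM ler_wpM2r ?sqn_ge0.
set q := n%:R * n.+1%:R in H vz *.
set k := s ^+ (n - J.+1) in H vz *.
rewrite -/q in AB.
move: (sqn (v J.+1) / _) (sqn (z * v J) / _) (sqn (v J) / _) H vz AB.
move=> e1 e2 e3 H vz AB; lra.
Qed.

Variable n : nat.

Definition fejer_poly (p : {poly C}) : {poly C} :=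
  \poly_(k < n.+1) ((n.+1 - k)%:R / n.+1%:R * p`_k).

Lemma drop_polyS (p : {poly C}) m :
  drop_poly m p = (p`_m)%:P + 'X * drop_poly m.+1 p.
Proof.
apply/polyP => -[|i]; rewrite !coefE /= ?addr0 ?add0r//.
by rewrite addnS addSn.
Qed.

Lemma horner_drop_polyS (p : {poly C}) m z :
  (drop_poly m p).[z] = p`_m + z * (drop_poly m.+1 p).[z].
Proof. by rewrite drop_polyS !hornerE. Qed.

Definition tail_energy (L : nat) (s : R) (p : {poly C}) (z : C) : R :=
  \sum_(m < L) s ^+ m * sqn (drop_poly m.+1 p).[z].

Lemma tail_energy_ge0 L s p z : 0 <= s -> 0 <= tail_energy L s p z.
Proof.
by move=> s0; apply: sumr_ge0 => i _; rewrite mulr_ge0 ?exprn_ge0 ?sqn_ge0.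
Qed.

Lemma fejer_tail_energy L (s : R) (p : {poly C}) (z : C) :
  (n < L)%N -> sqn z <= s ->
  tail_energy L s (fejer_poly p) z <= tail_energy L s p z.
Proof.
move=> nL zs; have s0 : 0 <= s by apply: le_trans zs; exact: sqn_ge0.
rewrite /tail_energy -!(big_mkord xpredT (fun m => s ^+ m * sqn (drop_poly m.+1 _).[z])).
rewrite (big_cat_nat (n := n.+1))//= [leRHS](big_cat_nat (n := n.+1))//=.
(* The Fejer mean has degree at most [n], so its tails beyond the split vanish, while those of [p]
   only enlarge the right side. *)
rewrite [X in _ + X](_ : _ = 0); last first.
  rewrite big_nat big1// => m /andP[nm _].
  rewrite drop_poly_eq0 ?horner0 ?sqn0 ?mulr0//.
  by rewrite (leq_trans (size_poly _ _))// (leq_trans nm)// leqnSn.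
rewrite addr0 ler_wpDr//.
  by apply: sumr_ge0 => i _; rewrite mulr_ge0 ?exprn_ge0 ?sqn_ge0.
rewrite !big_mkord.
(* Reversing the summation turns [t_m = p_m + z t_(m+1)] into a forward recursion that starts from a
   vanishing tail of the Fejer mean. *)
pose d j := (drop_poly (n - j).+1 p).[z].
pose y j := n.+1%:R * (drop_poly (n - j).+1 (fejer_poly p)).[z].
pose v := fix v j := if j is j'.+1 then d j + z * v j' else d 0%N.
have rv q : \sum_(m < n.+1) s ^+ m * sqn (drop_poly m.+1 q).[z] =
   \sum_(j < n.+1) s ^+ (n - j) * sqn (drop_poly (n - j).+1 q).[z].
  rewrite (reindex_inj rev_ord_inj)/=; apply: eq_bigr => i _.
  by rewrite subSS.
rewrite !rv -/d.
have n1 : 0 < n.+1%:R ^+ 2 :> R by rewrite exprn_gt0.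
rewrite -(ler_pM2l n1).
have yS j : (j < n)%N -> y j.+1 = j.+1%:R * (d j.+1 - z * d j) + z * y j.
  move=> jn; rewrite /y /d.
  rewrite [in LHS]subnSK// (horner_drop_polyS _ (n - j)) mulrDr.
  congr (_ + _); last by rewrite mulrCA.
  rewrite [in RHS]subnSK// (horner_drop_polyS p (n - j)) addrK.
  rewrite coef_poly ltnS leq_subr mulrA; congr (_ * _).
  rewrite mulrCA divff ?mulr1 ?pnatr_eq0//.
  by rewrite subSn ?leq_subr// subKn// ltnW.
have -> : n.+1%:R ^+ 2 * \sum_(j < n.+1) s ^+ (n - j) *
     sqn (drop_poly (n - j).+1 (fejer_poly p)).[z] =
   \sum_(j < n.+1) s ^+ (n - j) * sqn (y j).
  rewrite mulr_sumr; apply: eq_bigr => j _.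
  by rewrite /y sqnM sqn_natr mulrCA.
apply: le_trans (@fejer_telescope d v y z s n zs _ _ _ yS) _ => //.
  by rewrite /y subn0 drop_poly_eq0 ?horner0 ?mulr0// size_poly.
rewrite ler_wpM2r//.
  by apply: sumr_ge0 => i _; rewrite mulr_ge0 ?exprn_ge0 ?sqn_ge0.
(* The telescoping yields the factor [n (n + 1)], slightly better than the [(n + 1)^2] needed. *)
by rewrite expr2 ler_wpM2r// ler_nat.
Qed.

(** Expanding [|p_m + z t_(m+1)|^2] shows that the summand has real part
    [s^m (|t_m|^2 - |z|^2 |t_(m+1)|^2)], although it is itself a polynomial in [z]. *)
Definition energy_poly (L : nat) (s : R) (p : {poly C}) : {poly C} :=
  \sum_(m < L) (Complex (s ^+ m) 0)%:P *
    ((Complex (sqn p`_m) 0)%:P +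
      (2 * conjc p`_m)%:P * ('X * drop_poly m.+1 p)).

(* [Re Q] is the harmonic function with boundary values [|p|^2] on [|z|^2 = s]:
   this is the local Douglas formula for the Green potential of [|p'|^2]. *)
Lemma tail_energyE L (s : R) (p : {poly C}) (z : C) : (size p <= L)%N ->
  (s - sqn z) * tail_energy L s p z =
  Re (energy_poly L s p).[z] - sqn p.[z].
Proof.
move=> pL; rewrite /tail_energy /energy_poly horner_sum Re_sum.
apply/eqP; rewrite eq_sym subr_eq; apply/eqP.
transitivity (\sum_(m < L) (s ^+ m * sqn (drop_poly m p).[z] -
    s ^+ m * (sqn z * sqn (drop_poly m.+1 p).[z]))).
  apply: eq_bigr => i _; rewrite -mulrBr (horner_drop_polyS p i) !hornerE.
  case: (p`_i) => a b; case: (drop_poly i.+1 p).[z] => c d; case: z => x y.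
  rewrite /sqn/=; ring.
rewrite sumrB.
(* The index shift peels off [t_0 = p]; the extra top term vanishes because [size p <= L]. *)
have -> : \sum_(m < L) s ^+ m * sqn (drop_poly m p).[z] =
  s * (\sum_(m < L) s ^+ m * sqn (drop_poly m.+1 p).[z]) + sqn p.[z].
  have : \sum_(m < L.+1) s ^+ m * sqn (drop_poly m p).[z] =
         \sum_(m < L) s ^+ m * sqn (drop_poly m p).[z].
    by rewrite big_ord_recr/= drop_poly_eq0// horner0 sqn0 mulr0 addr0.
  move=> <-; rewrite big_ord_recl expr0 mul1r drop_poly0l addrC; congr (_ + _).
  rewrite mulr_sumr; apply: eq_bigr => i _.
  by rewrite mulrA -exprS.
rewrite mulrBl addrAC; congr (_ - _ + _).
by rewrite mulr_sumr; apply: eq_bigr => i _; rewrite mulrCA.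
Qed.

End FejerTails.

(** * Means over circles: Parseval and the mean value property *)

Section CircleMean.
Variable R : realType.
Local Notation C := (R[i]).
Local Notation Re := (@complex.Re R).
Local Notation Im := (@complex.Im R).
Local Notation mu := (@lebesgue_measure R).

Definition cis (t : R) : C := Complex (cos t) (sin t).

Lemma cisX t k : cis t ^+ k = Complex (cos (k%:R * t)) (sin (k%:R * t)).
Proof.
elim: k => [|k IH]; first by rewrite mul0r cos0 sin0 expr0.
rewrite exprSr IH -natr1 mulrDl mul1r cosD sinD /cis.
by apply/eqP; rewrite eq_complex/= addrC eqxx/= addrC.
Qed.

Lemma sqn_cis t : sqn (cis t) = 1.
Proof. by rewrite /sqn/= cos2Dsin2. Qed.

Lemma cabs_cis t : cabs (cis t) = 1.
Proof. by rewrite cabsE sqn_cis sqrtr1. Qed.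

Definition period : set (measurableTypeR R) := [set` `[0, 2 * pi]].

Lemma measurable_period : measurable (period : set (measurableTypeR R)).
Proof. exact: measurable_itv. Qed.

Lemma lebesgue_period : mu period = (2 * pi)%:E.
Proof.
rewrite /period lebesgue_measure_itv/= lte_fin mulr_gt0 ?pi_gt0//.
by rewrite oppr0 adde0.
Qed.

(** Integrability travels with the value, so that mean formulas can be combined linearly without
    further side conditions. *)
Definition has_mean (F : R -> R) (A : R) :=
  mu.-integrable period (EFin \o F) /\
  (\int[mu]_(t in period) (F t)%:E = (2 * pi * A)%:E)%E.

Lemma has_mean_ext F G A : F =1 G -> has_mean F A -> has_mean G A.
Proof. by move=> /funext ->. Qed.

Lemma has_mean_cst A : has_mean (fun=> A) A.
Proof.
split.
  apply: continuous_compact_integrable; first exact: segment_compact.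
  by apply: continuous_subspaceT => t; exact: cvg_cst.
rewrite (eq_integral (cst A%:E))// integral_cst; last exact: measurable_period.
by rewrite [X in (_ * X)%E]lebesgue_period -EFinM mulrC.
Qed.

Lemma has_meanD F G A B :
  has_mean F A -> has_mean G B -> has_mean (fun t => F t + G t) (A + B).
Proof.
move=> [iF eF] [iG eG]; split.
  exact (integrableD measurable_period iF iG).
under eq_integral do rewrite EFinD.
rewrite (integralD measurable_period iF iG)/=.
by rewrite eF eG -EFinD -(mulrDr (2 * pi)).
Qed.

Lemma has_meanZ k F A : has_mean F A -> has_mean (fun t => k * F t) (k * A).
Proof.
move=> [iF eF]; split.
  exact (integrableZl measurable_period k iF).
under eq_integral do rewrite EFinM.
by rewrite (integralZl measurable_period iF)/= eF -EFinM mulrCA.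
Qed.

Lemma has_meanN F A : has_mean F A -> has_mean (fun t => - F t) (- A).
Proof.
by move=> /(has_meanZ (-1)); rewrite mulN1r; apply: has_mean_ext => t;
  rewrite mulN1r.
Qed.

Lemma has_mean_sum (I : Type) (s : seq I) (P : pred I) (F : I -> R -> R) (A : I -> R) :
  (forall i, P i -> has_mean (F i) (A i)) ->
  has_mean (fun t => \sum_(i <- s | P i) F i t) (\sum_(i <- s | P i) A i).
Proof.
move=> H; elim: s => [|i s IH].
  rewrite big_nil; apply: has_mean_ext (has_mean_cst 0) => t.
  by rewrite big_nil.
rewrite big_cons; case: ifPn => Pi.
  apply: has_mean_ext (has_meanD (H _ Pi) IH) => t.
  by rewrite big_cons Pi.
by apply: has_mean_ext IH => t; rewrite big_cons (negbTE Pi).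
Qed.

Lemma has_mean_Re_cisX (a : C) k : (0 < k)%N ->
  has_mean (fun t => Re (a * cis t ^+ k)) 0.
Proof.
move=> k0; have kR : k%:R != 0 :> R by rewrite pnatr_eq0 -lt0n.
pose F (t : R) := Re a * cos (k%:R * t) - Im a * sin (k%:R * t).
apply: (@has_mean_ext F).
  by move=> t; rewrite cisX {}/F; case: a.
have cF : continuous F.
  move=> t; have ckt : {for t, continuous (fun t : R => k%:R * t)}.
    by apply: cvgM; [exact: cvg_cst|exact: cvg_id].
  apply: cvgB; apply: cvgM; try exact: cvg_cst.
    by apply: continuous_comp => //; exact: continuous_cos.
  by apply: continuous_comp => //; exact: continuous_sin.
have iF : mu.-integrable period (EFin \o F).
  apply: continuous_compact_integrable; first exact: segment_compact.
  exact: continuous_subspaceT.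
split => //.
pose G (t : R) := Re a / k%:R * sin (k%:R * t) + Im a / k%:R * cos (k%:R * t).
have dG (t : R) : is_derive t 1 G (F t).
  have dk : is_derive t 1 (fun t : R => k%:R * t) k%:R.
    by apply: is_derive_eq; rewrite /GRing.scale/= mulr1.
  have ds : is_derive t 1 (fun t : R => sin (k%:R * t)) (cos (k%:R * t) * k%:R).
    exact: is_derive1_comp.
  have dc : is_derive t 1 (fun t : R => cos (k%:R * t)) (- sin (k%:R * t) * k%:R).
    exact: is_derive1_comp.
  apply: is_derive_eq; rewrite /F /GRing.scale/=.
  by field.
rewrite mulr0 /period (@continuous_FTC2 _ _ G).
- rewrite /G mulr0 sin0 cos0 (_ : k%:R * (2 * pi) = 0 + (pi *+ 2) *+ k); last first.
    by rewrite mulr_natl add0r mulr_natl.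
  rewrite (periodicn (@sinD2pi R)) (periodicn (@cosD2pi R)) sin0 cos0.
  by rewrite -EFinB subrr.
- by rewrite mulr_gt0// pi_gt0.
- exact: continuous_subspaceT.
- split.
  + by move=> t _; case: (dG t).
  + apply: cvg_at_right_filter; apply: differentiable_continuous.
    by apply/derivable1_diffP; case: (dG 0).
  + apply: cvg_at_left_filter; apply: differentiable_continuous.
    by apply/derivable1_diffP; case: (dG (2 * pi)).
- by move=> t _; rewrite derive1E; case: (dG t).
Qed.

Lemma Re_mulJC (a b : C) : Re (a * conjc b) = Re (b * conjc a).
Proof. by case: a => ? ?; case: b => ? ? /=; ring. Qed.

Lemma has_mean_sqn_sum (K : nat) (p : nat -> C) :
  has_mean (fun t => sqn (\sum_(k < K) p k * cis t ^+ k))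
           (\sum_(k < K) sqn (p k)).
Proof.
have E t : sqn (\sum_(k < K) p k * cis t ^+ k) =
    \sum_(j < K) \sum_(k < K) Re (p j * cis t ^+ j * conjc (p k * cis t ^+ k)).
  transitivity (Re ((\sum_(k < K) p k * cis t ^+ k) *
      conjc (\sum_(k < K) p k * cis t ^+ k))).
    case: (\sum_(k < K) _) => a b; rewrite /sqn/=; ring.
  rewrite rmorph_sum mulr_suml Re_sum; apply: eq_bigr => j _.
  by rewrite mulr_sumr Re_sum.
apply: (@has_mean_ext (fun t => \sum_(j < K) \sum_(k < K)
    Re (p j * cis t ^+ j * conjc (p k * cis t ^+ k)))) => [t|]; first by rewrite E.
apply: has_mean_sum => j _.
rewrite (_ : sqn (p j) = \sum_(k < K) (if k == j then sqn (p k) else 0)); last first.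
  by rewrite -big_mkcond big_pred1_eq.
apply: has_mean_sum => k _.
(* On the unit circle conjugation inverts [cis t], so only the difference of the two exponents
   matters. *)
have red (a b : C) (l m : nat) t :
    Re (a * cis t ^+ (m + l) * conjc (b * cis t ^+ m)) =
    Re (a * conjc b * cis t ^+ l).
  rewrite rmorphM exprD mulrACA.
  have -> : cis t ^+ m * cis t ^+ l * conjc (cis t ^+ m) = cis t ^+ l.
    rewrite mulrAC.
    have -> (z : C) : z * conjc z = Complex (sqn z) 0.
      by case: z => x y; apply/eqP; rewrite eq_complex /sqn/=; apply/andP; split;
        apply/eqP; ring.
    by rewrite sqnX sqn_cis expr1n (mul1r (cis t ^+ l)).
  by [].
have [kj|jk|/val_inj <-] := ltngtP k j.
- rewrite ifF; last by apply/negbTE; rewrite -val_eqE/= ltn_eqF.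
  apply: has_mean_ext (@has_mean_Re_cisX (p j * conjc (p k)) (j - k) _) => [t|].
    by rewrite -[LHS](red _ _ _ k) (subnKC (ltnW kj)).
  by rewrite subn_gt0.
- rewrite ifF; last by apply/negbTE; rewrite -val_eqE/= gtn_eqF.
  apply: has_mean_ext (@has_mean_Re_cisX (p k * conjc (p j)) (k - j) _) => [t|].
    by rewrite -[LHS](red _ _ _ j) (subnKC (ltnW jk)) Re_mulJC.
  by rewrite subn_gt0.
rewrite eqxx; apply: has_mean_ext (has_mean_cst _) => t.
have := red (p k) (p k) 0%N k t; rewrite addn0 => ->; rewrite expr0 mulr1.
by case: (p k) => a b; rewrite /sqn/=; ring.
Qed.

Lemma horner_Taylor (p : {poly C}) (K : nat) z w : (size p <= K)%N ->
  p.[z + w] = \sum_(k < K) p^`N(k).[z] * w ^+ k.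
Proof.
by move=> pK; apply: nderiv_taylor_wide => //; exact: mulrC.
Qed.

Lemma circleE z r t : z - Complex r 0 * cis t = z + (- Complex r 0) * cis t.
Proof. by rewrite mulNr. Qed.

(** Parseval applied to the Taylor expansion at [z]. The circle is run through as [z - r e^(it)]
    because the translation in [circle_pairing] reverses the direction; the sign disappears in the
    even powers of [r]. *)
Lemma has_mean_sqn_horner (p : {poly C}) (K : nat) z (r : R) : (size p <= K)%N ->
  has_mean (fun t => sqn p.[z - Complex r 0 * cis t])
           (\sum_(k < K) r ^+ (k.*2) * sqn p^`N(k).[z]).
Proof.
move=> pK.
have := @has_mean_sqn_sum K (fun k => p^`N(k).[z] * (- Complex r 0) ^+ k).
rewrite (eq_bigr (fun k : 'I_K => r ^+ (k.*2) * sqn p^`N(k).[z])); last first.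
  move=> k _; rewrite sqnM sqnX sqnN mulrC; congr (_ * _).
  by rewrite {1}/sqn/= expr0n/= addr0 -exprM mul2n.
apply: has_mean_ext => t.
rewrite circleE (horner_Taylor _ _ pK); congr sqn; apply: eq_bigr => k _.
by rewrite exprMn mulrA.
Qed.

Lemma has_mean_Re_horner (p : {poly C}) z (r : R) :
  has_mean (fun t => Re p.[z - Complex r 0 * cis t]) (Re p.[z]).
Proof.
have pK : (size p <= (size p).+1)%N by [].
have H : has_mean (fun t => \sum_(k < (size p).+1)
    Re (p^`N(k).[z] * (- Complex r 0) ^+ k * cis t ^+ k))
  (\sum_(k < (size p).+1) if k == 0 :> nat then Re p.[z] else 0).
  apply: has_mean_sum => k _; case: eqP => [->|/eqP k0].
    apply: has_mean_ext (has_mean_cst _) => t.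
    by rewrite !expr0 !mulr1 nderivn0.
  by apply: has_mean_Re_cisX; rewrite lt0n.
rewrite big_ord_recl/= big1 ?addr0// in H.
apply: has_mean_ext H => t.
rewrite circleE (horner_Taylor _ _ pK) Re_sum; apply: eq_bigr => k _.
by rewrite exprMn mulrA.
Qed.

End CircleMean.

(** * Lebesgue measure on the plane: open sets, translations, Tonelli *)

Section Plane.
Variable R : realType.
Local Notation C := (R[i]).
Local Notation Re := (@complex.Re R).
Local Notation Im := (@complex.Im R).
Local Notation mu := (@lebesgue_measure R).

Local Notation plane := (measurableTypeR R * measurableTypeR R)%type.
Local Notation mu2 := (mu \x mu)%E.

Definition cplx (p : plane) : C := Complex p.1 p.2.

Lemma measurable_fun_x : measurable_fun setT (fun p : plane => p.1 : R).
Proof. exact: measurable_fst. Qed.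

Lemma measurable_fun_y : measurable_fun setT (fun p : plane => p.2 : R).
Proof. exact: measurable_snd. Qed.

(** Boxes with rational centres and half-widths [1/(n+1)] form a countable family, and those
    contained in [O] cover it. *)
Lemma measurable_open_plane (O : set plane) :
  (forall p, O p -> exists2 d : R, 0 < d &
     forall q : plane, `|q.1 - p.1| < d -> `|q.2 - p.2| < d -> O q) ->
  measurable O.
Proof.
move=> oO.
pose box (i : rat * rat * nat) : set plane :=
  [set` `](ratr i.1.1 - i.2.+1%:R^-1 : R), (ratr i.1.1 + i.2.+1%:R^-1)[%R] `*`
  [set` `](ratr i.1.2 - i.2.+1%:R^-1 : R), (ratr i.1.2 + i.2.+1%:R^-1)[%R].
pose F i := if `[< box i `<=` O >] then box i else set0.
have -> : O = \bigcup_i F i.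
  apply/seteqP; split => [p Op|p [i _]]; last first.
    by rewrite /F; case: ifPn => // /asboolP; apply.
  have [d d0 dO] := oO _ Op.
  (* With half-width below [d/2], a box that contains [p] stays within [d] of [p]. *)
  have [n nd] : exists n : nat, 2 * n.+1%:R^-1 < d.
    have /archi_boundP : 0 <= 2 / d by rewrite divr_ge0// ltW.
    set n := Num.bound _ => nn; exists n.
    rewrite ltr_pdivrMr// mulrC -ltr_pdivrMr//.
    by rewrite (lt_trans nn)// ltr_nat.
  have n0 : 0 < n.+1%:R^-1 :> R by rewrite invr_gt0.
  set e : R := n.+1%:R^-1 in nd n0.
  have rx (x : R) : exists q : rat, x - e < ratr q < x + e.
    have [|q] := @rat_in_itvoo R (x - e) (x + e).
      lra.
    by rewrite in_itv/= => h; exists q.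
  have [q1 /andP[q1a q1b]] := rx p.1.
  have [q2 /andP[q2a q2b]] := rx p.2.
  exists (q1, q2, n) => //; rewrite /F ifT.
    by split; rewrite /= in_itv/= -/e; apply/andP; split; lra.
  apply/asboolP => -[x y]/= [/=]; rewrite !in_itv/= -/e => /andP[a b] /andP[c ?].
  by apply: dO => /=; rewrite ltr_norml; apply/andP; split; lra.
apply: countable_bigcupT_measurable; first exact: countableP.
move=> i; rewrite /F; case: ifPn => // _.
by apply: measurableX; exact: measurable_itv.
Qed.

(** Lebesgue measure is determined by the lengths of half-open intervals, which translation
    preserves. *)
Lemma lebesgue_translation (a : R) (A : set (measurableTypeR R)) : measurable A ->
  pushforward mu (fun x : measurableTypeR R => (x + a : measurableTypeR R)) A = mu A.
Proof.
have ma : measurable_fun setT (fun x : measurableTypeR R => (x + a : measurableTypeR R)).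
  exact: (@measurable_funD _ _ _ setT (fun x : measurableTypeR R => x : R) (cst a)).
pose phi : {mfun measurableTypeR R >-> measurableTypeR R} :=
  HB.pack (fun x : measurableTypeR R => (x + a : measurableTypeR R))
   (isMeasurableFun.Build _ _ _ _ _ ma).
move=> mA; apply/esym.
apply: (@lebesgue_measure_unique R (pushforward mu phi)) => //= _ [[x y]] _ <-.
rewrite /pushforward.
rewrite (_ : _ @^-1` _ = `]x - a, y - a]%classic); last first.
  by apply/seteqP; split => t/=; rewrite !in_itv/= ltrBlDr lerBrDr.
rewrite !lebesgue_measure_itv/= !lte_fin ltrD2r -!EFinB.
by have -> : y - a - (x - a) = y - x by ring.
Qed.

Lemma ge0_integral_translation (a : R) (f : R -> \bar R) :
  measurable_fun (setT : set (measurableTypeR R)) f -> (forall x, 0 <= f x)%E ->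
  (\int[mu]_x f (x + a)%R = \int[mu]_x f x)%E.
Proof.
move=> mf f0.
have ma : measurable_fun setT (fun x : measurableTypeR R => (x + a : measurableTypeR R)).
  exact: (@measurable_funD _ _ _ setT (fun x : measurableTypeR R => x : R) (cst a)).
pose phi (x : measurableTypeR R) : measurableTypeR R := x + a.
transitivity (\int[pushforward mu phi]_x f x)%E.
  by rewrite ge0_integral_pushforward.
by apply: eq_measure_integral => A mA _; exact: lebesgue_translation.
Qed.

Lemma ge0_integral_translation2 (a : plane) (f : plane -> \bar R) :
  measurable_fun setT f -> (forall x, 0 <= f x)%E ->
  (\int[mu2]_p f (p.1 + a.1, p.2 + a.2)%R = \int[mu2]_p f p)%E.
Proof.
move=> mf f0.
have mt : measurable_fun setT (fun p : plane => (p.1 + a.1, p.2 + a.2) : plane).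
  apply: measurable_fun_pair.
    by apply: (@measurable_funD _ _ _ setT (fun p : plane => p.1 : R) (cst a.1)) => //;
      exact: measurable_fun_x.
  by apply: (@measurable_funD _ _ _ setT (fun p : plane => p.2 : R) (cst a.2)) => //;
      exact: measurable_fun_y.
rewrite fubini_tonelli1//; last exact: (measurableT_comp mf mt).
rewrite [in RHS]fubini_tonelli1//.
rewrite /fubini_F/=.
rewrite -[RHS](@ge0_integral_translation a.1).
- apply: eq_integral => x _.
  rewrite (@ge0_integral_translation a.2 (fun y => f (x + a.1, y)))//.
  exact: (measurableT_comp mf).
- exact: measurable_fun_fubini_tonelli_F.
- by move=> x; exact: integral_ge0.
Qed.

Section TonelliOn.
Context d1 d2 (T1 : measurableType d1) (T2 : measurableType d2).
Variables (m1 : {sigma_finite_measure set T1 -> \bar R})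
          (m2 : {sigma_finite_measure set T2 -> \bar R}).
Variables (D : set T2) (f : T1 * T2 -> \bar R).
Hypotheses (mD : measurable D) (mf : measurable_fun setT f).
Hypothesis f0 : (forall x, 0 <= f x)%E.

(** The restriction to [D] is absorbed into an indicator, so that Tonelli applies on the full
    product. *)
Let g (z : T1 * T2) := ((\1_D z.2)%:E * f z)%E.

Let mg : measurable_fun setT g.
Proof.
apply: emeasurable_funM => //; apply/measurable_EFinP.
apply: (@measurableT_comp _ _ _ _ _ _ (\1_D : T2 -> R) setT snd).
  exact: measurable_indic.
exact: measurable_snd.
Qed.

Let g0 z : (0 <= g z)%E.
Proof. by rewrite mule_ge0// lee_fin. Qed.

Let gE x : (\int[m2]_(y in D) f (x, y) = \int[m2]_y g (x, y))%E.
Proof.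
rewrite integral_mkcond; apply: eq_integral => y _.
rewrite /g patchE/= indicE; case: ifPn => yD; first by rewrite mul1e.
by rewrite mul0e.
Qed.

Lemma measurable_fun_integral_on :
  measurable_fun setT (fun x => \int[m2]_(y in D) f (x, y))%E.
Proof.
under eq_fun do rewrite gE.
exact: (@measurable_fun_fubini_tonelli_F _ _ _ _ _ m2 g mg g0).
Qed.

Lemma fubini_tonelli_on :
  (\int[m1]_x \int[m2]_(y in D) f (x, y) = \int[m2]_(y in D) \int[m1]_x f (x, y))%E.
Proof.
under eq_integral do rewrite gE.
rewrite (fubini_tonelli g)// [RHS]integral_mkcond; apply: eq_integral => y _.
rewrite /g patchE/= indicE; case: ifPn => yD.
  by under eq_integral do rewrite mul1e.
by rewrite integral0_eq// => x _; rewrite mul0e.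
Qed.

End TonelliOn.

Lemma sigma_finite_plane : sigma_finite setT (mu \x mu : set plane -> \bar R)%E.
Proof.
pose I n : set (measurableTypeR R) := [set` `[(- n%:R : R), n%:R]%R].
have mI n : measurable (I n) by exact: measurable_itv.
exists (fun n => I n `*` I n).
  apply/esym; rewrite -subTset => -[x y] _.
  exists (Num.bound (`|x : R| + `|y : R|)) => //.
  have /archi_boundP : 0 <= `|x : R| + `|y : R| by rewrite addr_ge0.
  set n := Num.bound _ => xyn.
  by split; rewrite /I /= in_itv/= -ler_norml; apply: le_trans (ltW xyn);
    rewrite ?lerDl ?lerDr.
move=> n; split; first exact: measurableX.
rewrite product_measure1E// [X in (X * _)%E]lebesgue_measure_itv.
rewrite [X in (_ * X)%E]lebesgue_measure_itv/=.
by case: ifP => _; rewrite ?mule0 ?ltry// -EFinB -EFinM ltry.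
Qed.

(** Tonelli is used below on the product of the plane and the interval of angles, which calls for
    the planar measure as a sigma-finite factor. *)
Definition plane_measure : {sigma_finite_measure set plane -> \bar R} :=
  HB.pack (mu \x mu)%E
    (Measure_isSigmaFinite.Build _ _ _ (mu \x mu)%E sigma_finite_plane).

End Plane.

(** * Pairing a weight with circular averages *)

Section Pairing.
Variable R : realType.
Local Notation C := (R[i]).
Local Notation Re := (@complex.Re R).
Local Notation Im := (@complex.Im R).
Local Notation mu := (@lebesgue_measure R).
Local Notation plane := (measurableTypeR R * measurableTypeR R)%type.
Local Notation mu2 := (mu \x mu)%E.

Lemma measurable_Re_Im_horner d (T : measurableType d) (D : set T) (f : T -> C) (p : {poly C}) :
  measurable_fun D (fun t => Re (f t)) -> measurable_fun D (fun t => Im (f t)) ->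
  measurable_fun D (fun t => Re p.[f t]) /\
  measurable_fun D (fun t => Im p.[f t]).
Proof.
move=> mr mi; elim/poly_ind: p => [|p c [IHr IHi]].
  by split; under eq_fun do rewrite horner0; exact: measurable_cst.
split.
- rewrite (_ : (fun t => _) = fun t => Re p.[f t] * Re (f t) - Im p.[f t] * Im (f t) + Re c).
    apply: measurable_funD; last exact: measurable_cst.
    by apply: measurable_funB; exact: measurable_funM.
  by apply/funext => t; rewrite hornerMXaddC ReD; case: (p.[f t]); case: (f t).
- rewrite (_ : (fun t => _) = fun t => Re p.[f t] * Im (f t) + Im p.[f t] * Re (f t) + Im c).
    apply: measurable_funD; last exact: measurable_cst.
    by apply: measurable_funD; exact: measurable_funM.
  by apply/funext => t; rewrite hornerMXaddC ImD; case: (p.[f t]); case: (f t).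
Qed.

Lemma measurable_sqn d (T : measurableType d) (D : set T) (f : T -> C) :
  measurable_fun D (fun t => Re (f t)) -> measurable_fun D (fun t => Im (f t)) ->
  measurable_fun D (fun t => sqn (f t)).
Proof. by move=> mr mi; apply: measurable_funD; exact: measurable_funX. Qed.

Lemma measurable_sqn_horner (p : {poly C}) :
  measurable_fun setT (fun w : plane => sqn p.[cplx w]).
Proof.
have [] := @measurable_Re_Im_horner _ _ setT (@cplx R) p
   (@measurable_fun_x R) (@measurable_fun_y R).
exact: measurable_sqn.
Qed.

Lemma measurable_sqn_cplx : measurable_fun setT (fun w : plane => sqn (cplx w)).
Proof.
by have := measurable_sqn_horner 'X; under eq_fun do rewrite hornerX.
Qed.

Lemma measurable_tail_energy L s (p : {poly C}) :
  measurable_fun setT (fun w : plane => tail_energy L s p (cplx w)).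
Proof.
rewrite /tail_energy; apply: measurable_sum => i.
by apply: measurable_funM; [exact: measurable_cst|exact: measurable_sqn_horner].
Qed.

Definition circ (w : plane) (r t : R) : plane := (w.1 + r * cos t, w.2 + r * sin t).

Lemma cplx_circ w r t : cplx (circ w r t) = cplx w + Complex (r * cos t) (r * sin t).
Proof. by []. Qed.

Lemma cplx_circN w r t : cplx (circ w (- r) t) = cplx w - Complex r 0 * cis t.
Proof.
by rewrite /cplx /circ; apply/eqP; rewrite eq_complex/=; apply/andP; split;
   apply/eqP; ring.
Qed.

Lemma measurable_circ (r : R) :
  measurable_fun setT (fun x : plane * measurableTypeR R => circ x.1 r x.2 : plane).
Proof.
have m1 : measurable_fun setT (fun x : plane * measurableTypeR R => x.1.1 : R).
  exact: (measurableT_comp (@measurable_fun_x R) measurable_fst).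
have m2 : measurable_fun setT (fun x : plane * measurableTypeR R => x.1.2 : R).
  exact: (measurableT_comp (@measurable_fun_y R) measurable_fst).
have mt : measurable_fun setT (fun x : plane * measurableTypeR R => x.2 : R).
  exact: measurable_snd.
have mtrig (h : R -> R) : continuous h ->
   measurable_fun setT (fun x : plane * measurableTypeR R => h x.2).
  by move=> ch; exact: (measurableT_comp (continuous_measurable_fun ch) mt).
apply: measurable_fun_pair.
  apply: measurable_funD => //; apply: measurable_funM; first exact: measurable_cst.
  by apply: mtrig; exact: continuous_cos.
apply: measurable_funD => //; apply: measurable_funM; first exact: measurable_cst.
by apply: mtrig; exact: continuous_sin.
Qed.

(** For each angle a translation moves the shift from [v] to [Om], and Tonelli restores the circular
    mean of [Om]. The mean inequality is asked only where [v] does not vanish, since circles around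
    other points may leave the disk. *)
Lemma circle_pairing (Om v : plane -> R) (r : R) :
  measurable_fun setT Om -> measurable_fun setT v ->
  (forall w, 0 <= Om w) -> (forall w, 0 <= v w) ->
  (forall w, v w != 0%R ->
    \int[mu]_(t in @period R) (Om (circ w r t))%:E <= (2 * pi * Om w)%:E)%E ->
  (\int[mu2]_z (\int[mu]_(t in @period R) (Om z * v (circ z (- r) t))%:E) <=
   \int[mu2]_z (2 * pi * (Om z * v z))%:E)%E.
Proof.
move=> mOm mv Om0 v0 H.
have mper := @measurable_period R.
have mOc : measurable_fun setT (fun x : plane * measurableTypeR R => Om (circ x.1 r x.2)).
  exact: (measurableT_comp mOm (measurable_circ r)).
have mvc : measurable_fun setT (fun x : plane * measurableTypeR R => v (circ x.1 (- r) x.2)).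
  exact: (measurableT_comp mv (measurable_circ (- r))).
have m1 : measurable_fun setT (fun x : plane * measurableTypeR R =>
    (Om x.1 * v (circ x.1 (- r) x.2))%:E).
  apply/measurable_EFinP; apply: measurable_funM => //.
  exact: (measurableT_comp mOm measurable_fst).
have m2 : measurable_fun setT (fun x : plane * measurableTypeR R =>
    (Om (circ x.1 r x.2) * v x.1)%:E).
  apply/measurable_EFinP; apply: measurable_funM => //.
  exact: (measurableT_comp mv measurable_fst).
pose M := @plane_measure R.
have sw1 := @fubini_tonelli_on R _ _ _ _ M mu _ _ mper m1.
rewrite /= in sw1; rewrite sw1; last by move=> x; rewrite lee_fin mulr_ge0.
have E (t : R) : (\int[mu2]_z (Om z * v (circ z (- r) t))%:E =
                  \int[mu2]_z (Om (circ z r t) * v z)%:E)%E.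
  rewrite -(@ge0_integral_translation2 R (r * cos t, r * sin t)
     (fun z => (Om z * v (circ z (- r) t))%:E)); last 2 first.
  - exact: (measurable_fun_pair1 _ m1).
  - by move=> x; rewrite lee_fin mulr_ge0.
  apply: eq_integral => -[x y] _ /=; do 3 f_equal.
  by rewrite /circ/=; congr (_, _); ring.
under eq_integral do rewrite E.
have sw2 := @fubini_tonelli_on R _ _ _ _ M mu _ _ mper m2.
rewrite /= in sw2; rewrite -sw2; last by move=> x; rewrite lee_fin mulr_ge0.
have mOt w : measurable_fun (@period R) (fun t => (Om (circ w r t))%:E).
  by apply: measurable_funTS; apply/measurable_EFinP; exact: (measurable_fun_pair2 w mOc).
have E2 w : (\int[mu]_(t in @period R) (Om (circ w r t) * v w)%:E =
   (v w)%:E * \int[mu]_(t in @period R) (Om (circ w r t))%:E)%E.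
  rewrite -ge0_integralZl//.
  - by apply: eq_integral => t _; rewrite -EFinM mulrC.
  - by move=> t _; rewrite lee_fin.
  - by rewrite lee_fin.
apply: ge0_le_integral => //.
- by move=> w _; apply: integral_ge0 => t _; rewrite lee_fin mulr_ge0.
- under eq_fun do rewrite E2.
  apply: emeasurable_funM; first exact/measurable_EFinP.
  have := @measurable_fun_integral_on R _ _ _ _ mu _
    (fun x : plane * measurableTypeR R => (Om (circ x.1 r x.2))%:E) mper.
  by apply; [exact/measurable_EFinP|move=> x; rewrite lee_fin].
- apply/measurable_EFinP; apply: measurable_funM; first exact: measurable_cst.
  exact: measurable_funM.
- move=> w _; rewrite E2; have [->|vw] := eqVneq (v w) 0.
    by rewrite mul0e mulr0 mulr0.
  rewrite mulrA mulrC EFinM lee_wpmul2l ?lee_fin//.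
  exact: H.
Qed.

End Pairing.

(** * The contraction for polynomials and bounded weights *)

Section KeyEstimate.
Variable R : realType.
Local Notation C := (R[i]).
Local Notation Re := (@complex.Re R).
Local Notation Im := (@complex.Im R).
Local Notation mu := (@lebesgue_measure R).
Local Notation plane := (measurableTypeR R * measurableTypeR R)%type.
Local Notation mu2 := (mu \x mu)%E.

Lemma sqn_horner_bounded (p : {poly C}) :
  exists2 M : R, 0 <= M & forall z, cabs z <= 1 -> sqn p.[z] <= M.
Proof.
exists ((\sum_(i < size p) cabs p`_i) ^+ 2); first exact: sqr_ge0.
move=> z z1; rewrite -sqr_cabs ler_sqr ?nnegrE ?cabs_ge0//; last first.
  by apply: sumr_ge0 => i _; exact: cabs_ge0.
rewrite horner_coef (le_trans (cabs_sum _ _ _))//; apply: ler_sum => i _.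
by rewrite cabsM cabsX ler_piMr ?cabs_ge0// exprn_ile1 ?cabs_ge0.
Qed.

Lemma sum_sqn_horner_bounded (I : Type) (s : seq I) (p : I -> {poly C}) :
  exists2 M : R, 0 <= M & forall z, cabs z <= 1 ->
    \sum_(i <- s) sqn (p i).[z] <= M.
Proof.
elim: s => [|i s [M M0 MP]]; first by exists 0 => // z _; rewrite big_nil.
have [N N0 NP] := sqn_horner_bounded (p i).
exists (N + M); first exact: addr_ge0.
by move=> z z1; rewrite big_cons lerD ?NP ?MP.
Qed.

Lemma tail_energy_bounded (L : nat) (s : R) (p : {poly C}) : 0 <= s -> s <= 1 ->
  exists2 M : R, 0 <= M & forall z, cabs z <= 1 -> tail_energy L s p z <= M.
Proof.
move=> s0 s1.
have [M M0 MP] := sum_sqn_horner_bounded (index_enum 'I_L)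
  (fun i : 'I_L => drop_poly i.+1 p).
exists M => // z z1; apply: le_trans (MP z z1); apply: ler_sum => i _.
by rewrite ler_piMl ?sqn_ge0// exprn_ile1.
Qed.

(** The difference of the two Green potentials, plus [delta (s - |z|^2)]: with [delta > 0] and [q] a
    Fejer mean of [p] this is strictly positive for [|z|^2 < s]. *)
Definition gap (L : nat) (s delta : R) (p q : {poly C}) (z : C) : R :=
  (s - sqn z) * (tail_energy L s p z - tail_energy L s q z + delta).

(** By [tail_energyE] the gap is the real part of a polynomial, which has the mean value property,
    plus a combination of [|p|^2], [|q|^2] and [|z|^2], whose means Parseval computes exactly. *)
Lemma has_mean_gap (L : nat) (s delta r : R) (p q : {poly C}) (z : C) :
  (size p <= L.+2)%N -> (size q <= L.+2)%N ->
  has_mean (fun t => gap L.+2 s delta p q (z - Complex r 0 * cis t))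
    (gap L.+2 s delta p q z -
      \sum_(k < L.+1) r ^+ k.+1.*2 * sqn p^`N(k.+1).[z] +
      \sum_(k < L.+1) r ^+ k.+1.*2 * sqn q^`N(k.+1).[z] - delta * r ^+ 2).
Proof.
move=> pL qL.
have gapE w : gap L.+2 s delta p q w =
  Re (energy_poly L.+2 s p).[w] + - sqn p.[w] +
  (- Re (energy_poly L.+2 s q).[w] + sqn q.[w]) +
  (delta * s + (- delta) * sqn ('X : {poly C}).[w]).
  by rewrite /gap mulrDr mulrBr !tail_energyE// hornerX; ring.
have X2 : (size ('X : {poly C}) <= 2)%N by rewrite size_polyX.
have H := has_meanD (has_meanD
  (has_meanD (has_mean_Re_horner (energy_poly L.+2 s p) z r)
             (has_meanN (has_mean_sqn_horner z r pL)))
  (has_meanD (has_meanN (has_mean_Re_horner (energy_poly L.+2 s q) z r))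
             (has_mean_sqn_horner z r qL)))
  (has_meanD (has_mean_cst (delta * s))
             (has_meanZ (- delta) (has_mean_sqn_horner z r X2))).
have XE : \sum_(k < 2) r ^+ k.*2 * sqn ('X : {poly C})^`N(k).[z] = sqn z + r ^+ 2.
  rewrite !big_ord_recl big_ord0 /= double0 expr0 mul1r nderivn0 addr0.
  by rewrite nderivn1 derivX hornerX hornerC -[1]/(1%:R) sqn_natr expr1n mulr1.
set A := (X in has_mean _ X) in H.
have -> : gap L.+2 s delta p q z -
      \sum_(k < L.+1) r ^+ k.+1.*2 * sqn p^`N(k.+1).[z] +
      \sum_(k < L.+1) r ^+ k.+1.*2 * sqn q^`N(k.+1).[z] - delta * r ^+ 2 = A.
  rewrite /A XE gapE !(big_ord_recl L.+1) /= double0 !expr0 !mul1r !nderivn0.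
  by rewrite !hornerX; ring.
by apply: has_mean_ext H => t; rewrite gapE.
Qed.

End KeyEstimate.

Section KeyEstimate2.
Variable R : realType.
Local Notation C := (R[i]).
Local Notation Re := (@complex.Re R).
Local Notation Im := (@complex.Im R).
Local Notation mu := (@lebesgue_measure R).
Local Notation plane := (measurableTypeR R * measurableTypeR R)%type.
Local Notation mu2 := (mu \x mu)%E.

(** Isolates the discrete Laplacian. In orders [r^4] and above, the terms of [p] are absorbed in [M]
    because [r <= 1], and those of [q] have the favourable sign. *)
Lemma mean_gap_lower (L : nat) (s delta r M : R) (p q : {poly C}) (z : C) :
  0 <= r -> r <= 1 -> \sum_(k < L) sqn p^`N(k.+2).[z] <= M ->
  gap L.+2 s delta p q z +
    r ^+ 2 * (sqn q^`().[z] - sqn p^`().[z] - delta - r ^+ 2 * M) <=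
  gap L.+2 s delta p q z -
    \sum_(k < L.+1) r ^+ k.+1.*2 * sqn p^`N(k.+1).[z] +
    \sum_(k < L.+1) r ^+ k.+1.*2 * sqn q^`N(k.+1).[z] - delta * r ^+ 2.
Proof.
move=> r0 r1 HM; rewrite !big_ord_recl /= !nderivn1.
have A : \sum_(i < L) r ^+ (bump 0 i).+1.*2 * sqn p^`N((bump 0 i).+1).[z] <=
    r ^+ 4 * M.
  apply: (@le_trans _ _ (r ^+ 4 * \sum_(k < L) sqn p^`N(k.+2).[z])).
    rewrite mulr_sumr; apply: ler_sum => i _; rewrite ler_wpM2r ?sqn_ge0//.
    by rewrite ler_wiXn2l// /bump add1n !doubleS.
  by rewrite ler_wpM2l// exprn_ge0.
have B : 0 <= \sum_(i < L) r ^+ (bump 0 i).+1.*2 * sqn q^`N((bump 0 i).+1).[z].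
  by apply: sumr_ge0 => i _; rewrite mulr_ge0 ?exprn_ge0 ?sqn_ge0.
have -> : r ^+ 1.*2 = r ^+ 2 by [].
have r4 : r ^+ 4 * M = r ^+ 2 * (r ^+ 2 * M) by rewrite mulrA -exprD.
lra.
Qed.

Definition odisk (rho : R) : set plane := [set w | sqn (cplx w) < rho ^+ 2].

Lemma measurable_odisk rho : measurable (odisk rho).
Proof.
have := @measurable_fun_ltr _ _ _ setT _ _ (@measurable_sqn_cplx R)
  (measurable_cst (rho ^+ 2)).
move=> /(_ measurableT [set true]).
by rewrite setTI preimage_true; exact.
Qed.

Lemma odisk_measure_le rho : 0 <= rho -> rho <= 1 -> (mu2 (odisk rho) <= 4%:E)%E.
Proof.
move=> rho0 rho1.
pose I : set (measurableTypeR R) := [set` `[(-1 : R), 1]%R].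
have mI : measurable I by exact: measurable_itv.
have -> : 4%:E = mu2 (I `*` I).
  rewrite product_measure1E// [X in (X * _)%E]lebesgue_measure_itv.
  rewrite [X in (_ * X)%E]lebesgue_measure_itv/= lte_fin.
  rewrite ifT; last by lra.
  by rewrite -EFinB -EFinM; congr (_%:E); ring.
apply: (@le_measure _ _ _ mu2) => //; rewrite ?inE.
- exact: measurable_odisk.
- exact: measurableX.
move=> -[x y]; rewrite /odisk /sqn/= => xy.
have r1 : rho ^+ 2 <= 1 by rewrite exprn_ile1.
have nn a : `|a : R| ^+ 2 <= 1 -> -1 <= a <= 1.
  by rewrite -ler_norml; rewrite -{1}(expr1n _ 2) ler_pXn2r ?nnegrE.
split; rewrite /I/= in_itv/=; apply: nn; rewrite real_normK ?num_real//.
  by have := sqr_ge0 (y : R); lra.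
by have := sqr_ge0 (x : R); lra.
Qed.

(** The test function is [v = max (g - eps) 0 / (2 pi r^2)] inside radius [rho]. Where it is
    nonzero, its integral over the angles exceeds [2 pi v] by at least [|q'|^2 - |p'|^2 - c];
    integrating against [Om] and applying [circle_pairing] compares the two energies up to [eta]. *)
Lemma fejer_contraction_poly (n : nat) (p : {poly C}) (Om : plane -> R) (N rho1 rho : R) :
  measurable_fun setT Om -> (forall w, 0 <= Om w) -> (forall w, Om w <= N) ->
  (forall (w : plane) (r : R), (0 < r)%R -> (cabs (cplx w) + r < 1)%R ->
    \int[mu]_(t in @period R) (Om (circ w r t))%:E <= (2 * pi * Om w)%:E)%E ->
  0 <= rho1 -> rho1 < rho -> rho < 1 ->
  (\int[mu2]_(w in odisk rho1) (sqn (fejer_poly n p)^`().[cplx w] * Om w)%:E <=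
   \int[mu2]_(w in odisk rho) (sqn p^`().[cplx w] * Om w)%:E)%E.
Proof.
move=> mOm Om0 OmN Omean rho10 rho1rho rho_lt1.
set q := fejer_poly n p.
have rho0 : 0 < rho by lra.
have N0 : 0 <= N by apply: le_trans (Om0 0) (OmN 0).
set s := rho ^+ 2.
have s0 : 0 <= s by rewrite sqr_ge0.
have s1 : s <= 1 by rewrite exprn_ile1// ltW.
have srho1 : rho1 ^+ 2 < s by rewrite ltr_pXn2r// nnegrE// ltW.
pose L := maxn (size p) n.+1.
have pL : (size p <= L.+2)%N by rewrite -addn2 (leq_trans _ (leq_addr _ _))// leq_maxl.
have qL : (size q <= L.+2)%N.
  by rewrite (leq_trans (size_poly _ _))// -addn2 (leq_trans _ (leq_addr _ _))// leq_maxr.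
have nL : (n < L.+2)%N by rewrite -addn2 (leq_trans _ (leq_addr _ _))// leq_maxr.
have [K K0 KP] := @tail_energy_bounded R L.+2 s q s0 s1.
have [M M0 MP] := sum_sqn_horner_bounded (index_enum 'I_L)
  (fun k : 'I_L => p^`N(k.+2)).
apply/lee_addgt0Pr => eta eta0.
(* [W] bounds the mass of the weight on the disk. The final error is [(delta + r^2 M) W], and each
   of its two parts is given [eta / 2]. *)
pose W := 4 * N.
have W0 : 0 <= W by rewrite mulr_ge0.
pose delta := eta / (2 * (W + 1)).
have delta0 : 0 < delta by rewrite divr_gt0// mulr_gt0//; lra.
have deltaW : delta * W <= eta / 2.
  rewrite /delta mulrAC ler_pdivrMr; last by lra.
  by rewrite (_ : _ / 2 * _ = eta * (W + 1)) ?ler_pM2l//; [lra|field].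
(* On [odisk rho1] the term [delta (s - |z|^2)] exceeds twice this value, so [g - eps] stays
   positive there. *)
pose eps := delta * (s - rho1 ^+ 2) / 2.
have eps0 : 0 < eps by rewrite divr_gt0// mulr_gt0// subr_gt0.
(* The three bounds keep the circles inside the unit disk, keep [g] below [eps] on the collar
   between the radii [rho] and [rho + r], and make the Taylor remainder small. *)
pose r := Num.min ((1 - rho) / 2)
  (Num.min (eps / (3 * (K + 1))) (eta / (2 * (M * W + 1)))).
have MW0 : 0 <= M * W by rewrite mulr_ge0.
have r0 : 0 < r.
  rewrite !lt_min; apply/and3P; split; first by lra.
    by rewrite divr_gt0// mulr_gt0//; lra.
  by rewrite divr_gt0// mulr_gt0//; lra.
have r_rho : r <= (1 - rho) / 2 by rewrite /r ge_min lexx.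
have r1 : r <= 1 by lra.
have r_eps : r * (3 * (K + 1)) <= eps.
  rewrite -ler_pdivlMr; last by rewrite mulr_gt0//; lra.
  by rewrite /r !ge_min lexx ?orbT.
have r_eta : r ^+ 2 * M * W <= eta / 2.
  have : r * (2 * (M * W + 1)) <= eta.
    rewrite -ler_pdivlMr; last by rewrite mulr_gt0//; lra.
    by rewrite /r !ge_min lexx ?orbT.
  have : r ^+ 2 * (M * W) <= r * (M * W).
    by rewrite ler_wpM2r// expr2 ler_piMr// ltW.
  by rewrite -mulrA; lra.
have r20 : 0 < r ^+ 2 by rewrite exprn_gt0.
have pi20 : 0 < 2 * pi :> R by rewrite mulr_gt0// pi_gt0.
pose g (z : C) := gap L.+2 s delta p q z.
have g_in z : sqn z <= s -> (s - sqn z) * delta <= g z.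
  move=> zs; rewrite /g /gap ler_wpM2l ?subr_ge0//.
  by rewrite lerDr subr_ge0 fejer_tail_energy.
(* Beyond radius [rho] the factor [s - |z|^2] changes sign, and only the tail energy of [q] can make
   [g] positive. On the collar [|z|^2 - s <= 2 rho r + r^2 <= 3 r]. *)
have g_out z : s <= sqn z -> cabs z <= rho + r -> g z <= eps.
  move=> zs zr; apply: le_trans r_eps.
  have z1 : cabs z <= 1 by lra.
  apply: (@le_trans _ _ ((sqn z - s) * K)).
    rewrite /g /gap; have := KP _ z1; have := @tail_energy_ge0 R L.+2 s p z s0.
    set a := tail_energy _ _ _ _; set b := tail_energy _ _ _ _ => a0 bK.
    by have : 0 <= (sqn z - s) * (a + delta + (K - b)); [rewrite mulr_ge0; lra|lra].
  have : sqn z - s <= 3 * r.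
    have : sqn z <= (rho + r) ^+ 2 by rewrite -cabs_le//; lra.
    rewrite /s; have : 0 <= r * (1 - r) by rewrite mulr_ge0; lra.
    have : 0 <= r * (1 - rho) by rewrite mulr_ge0; lra.
    by rewrite !expr2; lra.
  move=> zr3; apply: (@le_trans _ _ (3 * r * K)); first by rewrite ler_wpM2r.
  by lra.
pose v (w : plane) : R :=
  if sqn (cplx w) < s then Num.max (g (cplx w) - eps) 0 / (2 * pi * r ^+ 2) else 0.
have c0 : 0 < 2 * pi * r ^+ 2 by rewrite mulr_gt0.
have v0 w : 0 <= v w.
  rewrite /v; case: ifP => // _; rewrite divr_ge0 ?(ltW c0)//.
  by rewrite le_max lexx orbT.
have mg : measurable_fun setT (fun w : plane => g (cplx w)).
  rewrite /g /gap; apply: measurable_funM.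
    by apply: measurable_funB; [exact: measurable_cst|exact: measurable_sqn_cplx].
  apply: measurable_funD; last exact: measurable_cst.
  by apply: measurable_funB; exact: measurable_tail_energy.
have mv : measurable_fun setT v.
  apply: measurable_fun_ifT; last exact: measurable_cst.
    by apply: measurable_fun_ltr; [exact: measurable_sqn_cplx|exact: measurable_cst].
  apply: measurable_funM; last exact: measurable_cst.
  apply: measurable_maxr; last exact: measurable_cst.
  by apply: measurable_funB => //; exact: measurable_cst.
(* Setting [v] to zero outside the disk loses nothing: on the collar the left side is nonpositive by
   [g_out]. *)
have v_lower w : cabs (cplx w) <= rho + r ->
    (g (cplx w) - eps) / (2 * pi * r ^+ 2) <= v w.
  move=> wr; rewrite /v; case: ltP => ws.
    by rewrite ler_pM2r ?invr_gt0// le_max lexx.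
  by rewrite pmulr_lle0 ?invr_gt0// subr_le0 g_out.
have v_upper w : v w <= `|(g (cplx w) - eps) / (2 * pi * r ^+ 2)|.
  rewrite /v; case: ifP => // _; rewrite normrM [X in _ <= _ * X]gtr0_norm ?invr_gt0//.
  by rewrite ler_pM2r ?invr_gt0// ge_max ler_norm normr_ge0.
(* The uniform bound makes the integral of [Om * v] finite, so that it can be cancelled at the
   end. *)
have [B Bv] : exists B, forall w, v w <= B.
  have [Kp Kp0 KpP] := @tail_energy_bounded R L.+2 s p s0 s1.
  exists (`|(Kp + K + delta) / (2 * pi * r ^+ 2)|) => w; rewrite /v; case: ifP => // ws.
  rewrite normrM [X in _ <= _ * X]gtr0_norm ?invr_gt0// ler_pM2r ?invr_gt0//.
  rewrite ge_max normr_ge0 andbT (le_trans _ (ler_norm _))//.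
  have w1 : cabs (cplx w) <= 1.
    by rewrite cabs_le// expr1n (le_trans (ltW ws)).
  have := KpP _ w1; have := KP _ w1; rewrite /g /gap.
  have := @tail_energy_ge0 R L.+2 s p (cplx w) s0.
  have := @tail_energy_ge0 R L.+2 s q (cplx w) s0.
  set a := tail_energy _ _ q _; set b := tail_energy _ _ p _ => a0 b0 aK bK.
  have : 0 <= (1 - (s - sqn (cplx w))) * (b + a + delta).
    by have w0 := sqn_ge0 (cplx w); rewrite mulr_ge0//; lra.
  have : 0 <= (s - sqn (cplx w)) * a by rewrite mulr_ge0// subr_ge0 ltW.
  lra.
have pairing := @circle_pairing R Om v r mOm mv Om0 v0.
have vsupp w : v w != 0 -> sqn (cplx w) < s.
  by rewrite /v; case: ifP => // _; rewrite eqxx.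
have {}pairing : (\int[mu2]_z (\int[mu]_(t in @period R) (Om z * v (circ z (- r) t))%:E) <=
   \int[mu2]_z (2 * pi * (Om z * v z))%:E)%E.
  apply: pairing => w vw; apply: Omean => //.
  have := vsupp _ vw; rewrite -cabs_lt; lra.
(* [F1] and [F3] are the two sides of the pairing, [F2] and [F4] the energy densities, and [c]
   collects the errors. Arranging the pointwise estimate as [F1 + F2 <= F3 + F4] avoids differences
   of integrals. *)
pose F1 (w : plane) := (2 * pi * (Om w * v w))%:E.
pose F2 := ((fun w : plane => (sqn q^`().[cplx w] * Om w)%:E) \_ (odisk rho1)).
pose F3 (w : plane) := (\int[mu]_(t in @period R) (Om w * v (circ w (- r) t))%:E)%E.
pose c := delta + r ^+ 2 * M.
pose F4 := ((fun w : plane => ((sqn p^`().[cplx w] + c) * Om w)%:E) \_ (odisk rho)).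
have F_le w : (F1 w + F2 w <= F3 w + F4 w)%E.
  have F30 : (0 <= F3 w)%E.
    by apply: integral_ge0 => t _; rewrite lee_fin mulr_ge0.
  have c00 : 0 <= c by apply: addr_ge0; [exact: ltW|rewrite mulr_ge0// ltW].
  have F40 : (0 <= F4 w)%E.
    rewrite /F4 patchE; case: ifP => // _.
    by rewrite lee_fin mulr_ge0// addr_ge0// sqn_ge0.
  (* Where [v] vanishes [F2] vanishes as well, because [v] is positive on [odisk rho1]. *)
  have [vw|vw] := eqVneq (v w) 0.
    rewrite {1}/F1 vw !mulr0 add0e /F2 patchE; case: ifPn => [|_]; last exact: adde_ge0.
    rewrite inE /odisk/= => w1.
    exfalso; move: vw; rewrite /v ifT; last by lra.
    apply/eqP; rewrite gt_eqF// divr_gt0// lt_max; apply/orP; left.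
    have := @g_in (cplx w); rewrite (ltW (lt_trans w1 srho1)) => /(_ isT).
    have : (s - rho1 ^+ 2) * delta <= (s - sqn (cplx w)) * delta.
      by rewrite ler_pM2r// lerB// ltW.
    have : eps * 2 = (s - rho1 ^+ 2) * delta by rewrite /eps; field.
    lra.
  have ws := vsupp _ vw.
  have w1 : cabs (cplx w) <= 1 by rewrite cabs_le// expr1n (le_trans (ltW ws)).
  have F4E : F4 w = ((sqn p^`().[cplx w] + c) * Om w)%:E.
    by rewrite /F4 patchE ifT// inE.
  have F2le : (F2 w <= (sqn q^`().[cplx w] * Om w)%:E)%E.
    rewrite /F2 patchE; case: ifP => // _.
    by rewrite lee_fin mulr_ge0 ?sqn_ge0.
  have := @has_mean_gap R L s delta r p q (cplx w) pL qL.
  set A := (X in has_mean _ X) => -[iA eA].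
  have Alow := @mean_gap_lower L s delta r M p q (cplx w) (ltW r0) r1 (MP _ w1).
  rewrite -/A in Alow.
  pose h (t : R) := g (cplx w - Complex r 0 * cis t).
  have [ih eh] : has_mean (fun t => (2 * pi * r ^+ 2)^-1 * (h t - eps))
      ((2 * pi * r ^+ 2)^-1 * (A - eps)).
    apply: has_meanZ; apply: has_meanD; first by split.
    by apply: has_meanN; exact: has_mean_cst.
  (* The circle stays in [|z| <= rho + r], where [v_lower] replaces [v] by an affine image of the
     gap, whose mean is known. *)
  have F3low : (((2 * pi) * ((2 * pi * r ^+ 2)^-1 * (A - eps)) * Om w)%:E <= F3 w)%E.
    have mvt : measurable_fun setT (fun t : measurableTypeR R => v (circ w (- r) t)).
      exact: (measurable_fun_pair2 w (measurableT_comp mv (measurable_circ (- r)))).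
    have mvt' : measurable_fun (@period R) (fun t : measurableTypeR R => (v (circ w (- r) t))%:E).
      by apply: measurable_funTS; exact/measurable_EFinP.
    have -> : F3 w = ((Om w)%:E * \int[mu]_(t in @period R) (v (circ w (- r) t))%:E)%E.
      rewrite -ge0_integralZl//.
      - exact: measurable_period.
      - by move=> t _; rewrite lee_fin.
      - by rewrite lee_fin.
    rewrite mulrC EFinM lee_wpmul2l ?lee_fin// -eh.
    apply: le_integral => //.
    - exact: measurable_period.
    - apply: (le_integrable _ mvt' _ ih); first exact: measurable_period.
      move=> t _ /=; rewrite lee_fin ger0_norm// (le_trans (v_upper _))//.
      by rewrite cplx_circN mulrC.
    - move=> t _; rewrite lee_fin mulrC -/h /h -cplx_circN v_lower//.
      rewrite cplx_circN (le_trans (cabsB _ _))// cabsM cabs_cis mulr1 cabs_real.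
      rewrite gtr0_norm// lerD2r cabs_le; last by lra.
      exact: ltW.
  apply: le_trans (leeD F3low (lexx _)).
  apply: le_trans (leeD (lexx _) F2le) _.
  rewrite F4E /F1 -!EFinD lee_fin.
  have -> : 2 * pi * ((2 * pi * r ^+ 2)^-1 * (A - eps)) = (A - eps) / r ^+ 2.
    by move: (2 * pi) pi20 => P P0; field; rewrite !gt_eqF.
  have -> : 2 * pi * (Om w * v w) = (g (cplx w) - eps) / r ^+ 2 * Om w.
    rewrite /v ws max_l; first by move: (2 * pi) pi20 => P P0; field; rewrite !gt_eqF.
    rewrite leNgt; apply/negP => gneg; move: vw; rewrite /v ws max_r ?mul0r ?eqxx//.
    exact: ltW.
  rewrite -!mulrDl ler_wpM2r// /c.
  have -> : (A - eps) / r ^+ 2 = (g (cplx w) - eps) / r ^+ 2 + (A - g (cplx w)) / r ^+ 2.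
    by rewrite -mulrDl; congr (_ / _); ring.
  suff : sqn q^`().[cplx w] - sqn p^`().[cplx w] - delta - r ^+ 2 * M <=
     (A - g (cplx w)) / r ^+ 2 by lra.
  by rewrite ler_pdivlMr// mulrC; rewrite -/g in Alow; rewrite /g; lra.
have mF1 : measurable_fun setT F1.
  apply/measurable_EFinP; apply: measurable_funM; first exact: measurable_cst.
  exact: measurable_funM.
have mF2 : measurable_fun setT F2.
  apply/(measurable_restrictT _ (measurable_odisk rho1)); apply: measurable_funTS.
  by apply/measurable_EFinP; apply: measurable_funM => //; exact: measurable_sqn_horner.
have mF3 : measurable_fun setT F3.
  apply: (@measurable_fun_integral_on R _ _ _ _ mu _
    (fun x : plane * measurableTypeR R => (Om x.1 * v (circ x.1 (- r) x.2))%:E)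
    (@measurable_period R)).
    apply/measurable_EFinP; apply: measurable_funM.
      exact: (measurableT_comp mOm measurable_fst).
    exact: (measurableT_comp mv (measurable_circ (- r))).
  by move=> x; rewrite lee_fin mulr_ge0.
have c00 : 0 <= c by apply: addr_ge0; [exact: ltW|rewrite mulr_ge0// ltW].
have mF4 : measurable_fun setT F4.
  apply/(measurable_restrictT _ (measurable_odisk rho)); apply: measurable_funTS.
  apply/measurable_EFinP; apply: measurable_funM => //.
  by apply: measurable_funD; [exact: measurable_sqn_horner|exact: measurable_cst].
have F10 w : (0 <= F1 w)%E by rewrite lee_fin !mulr_ge0// pi_ge0.
have F20 w : (0 <= F2 w)%E.
  by rewrite /F2 patchE; case: ifP => // _; rewrite lee_fin mulr_ge0 ?sqn_ge0.
have F30 w : (0 <= F3 w)%E.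
  by apply: integral_ge0 => t _; rewrite lee_fin mulr_ge0.
have F40 w : (0 <= F4 w)%E.
  rewrite /F4 patchE; case: ifP => // _.
  by rewrite lee_fin mulr_ge0// addr_ge0// sqn_ge0.
have main : (\int[mu2]_w F1 w + \int[mu2]_w F2 w <=
             \int[mu2]_w F3 w + \int[mu2]_w F4 w)%E.
  rewrite -!ge0_integralD//; apply: ge0_le_integral => //.
  - by move=> w _; exact: adde_ge0.
  - exact: emeasurable_funD.
  - exact: emeasurable_funD.
have B0 : 0 <= B by apply: le_trans (v0 0) (Bv 0).
have I1fin : (\int[mu2]_w F1 w)%E \is a fin_num.
  rewrite ge0_fin_numE; last by exact: integral_ge0.
  have -> : F1 = (F1 \_ (odisk rho)).
    apply/funext => w; rewrite patchE; case: ifPn => //; rewrite notin_setE /odisk/= => wr.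
    have [vw|/vsupp//] := eqVneq (v w) 0.
    by rewrite /F1 vw !mulr0.
  rewrite -integral_mkcond.
  apply: (@le_lt_trans _ _ (\int[mu2]_(w in odisk rho) (cst (2 * pi * (N * B))%:E) w)%E).
    apply: ge0_le_integral => //.
    - exact: measurable_odisk.
    - exact: measurable_funTS.
    - move=> w _; rewrite lee_fin ler_wpM2l ?mulr_ge0 ?pi_ge0//.
      exact: ler_pM.
  rewrite integral_cst; last exact: measurable_odisk.
  rewrite lte_mul_pinfty//.
  - by rewrite lee_fin !mulr_ge0// pi_ge0.
  - by rewrite (le_lt_trans (odisk_measure_le (ltW rho0) (ltW rho_lt1)))// ltry.
rewrite integral_mkcond -/F2.
have {}main : (\int[mu2]_w F2 w <= \int[mu2]_w F4 w)%E.
  rewrite -(leeD2lE _ _ I1fin); apply: le_trans main _.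
  exact: leeD2r.
apply: le_trans main _.
rewrite -integral_mkcond.
have mp' : measurable_fun (odisk rho) (fun w : plane => (sqn p^`().[cplx w] * Om w)%:E).
  apply: measurable_funTS; apply/measurable_EFinP; apply: measurable_funM => //.
  exact: measurable_sqn_horner.
apply: (@le_trans _ _ (\int[mu2]_(w in odisk rho)
   ((sqn p^`().[cplx w] * Om w)%:E + (cst (c * N)%:E) w))%E).
  apply: ge0_le_integral => //.
  - exact: measurable_odisk.
  - by move=> w _; rewrite lee_fin mulr_ge0// addr_ge0// sqn_ge0.
  - apply: measurable_funTS; apply/measurable_EFinP; apply: measurable_funM => //.
    by apply: measurable_funD; [exact: measurable_sqn_horner|exact: measurable_cst].
  - by apply: emeasurable_funD.
  - move=> w _; rewrite -EFinD lee_fin mulrDl lerD2l.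
    by rewrite ler_wpM2l.
rewrite ge0_integralD//;
  try exact: measurable_odisk;
  try by move=> w _; rewrite lee_fin mulr_ge0// sqn_ge0.
apply: leeD2l; rewrite integral_cst; last exact: measurable_odisk.
apply: (@le_trans _ _ ((c * N)%:E * 4%:E)%E).
  rewrite lee_wpmul2l ?lee_fin ?mulr_ge0//.
  exact: (odisk_measure_le (ltW rho0) (ltW rho_lt1)).
rewrite -EFinM lee_fin /c; move: deltaW r_eta; rewrite /W.
lra.
Qed.

End KeyEstimate2.

(** * Power series, Taylor polynomials and Fejer means *)

Section PowerSeries.
Variable R : realType.
Local Notation C := (R[i]).
Local Notation Re := (@complex.Re R).
Local Notation Im := (@complex.Im R).
Implicit Types (a u w : nat -> C) (z : C).

Lemma geometric_sum_le (y : R) n : 0 <= y -> y < 1 ->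
  \sum_(k < n) y ^+ k <= (1 - y)^-1.
Proof.
move=> y0 y1; rewrite -[leRHS]mul1r ler_pdivlMr ?subr_gt0//.
have -> : (\sum_(k < n) y ^+ k) * (1 - y) = 1 - y ^+ n.
  by rewrite mulrC -opprB mulNr -subrX1 opprB.
by rewrite gerBl exprn_ge0.
Qed.

(** [y^k] is the smallest of the [k + 1] terms of the geometric sum. *)
Lemma succ_expr_le (y : R) k : 0 <= y -> y < 1 -> k.+1%:R * y ^+ k <= (1 - y)^-1.
Proof.
move=> y0 y1; apply: le_trans (geometric_sum_le k.+1 y0 y1).
rewrite mulr_natl -[X in _ *+ X]card_ord -sumr_const.
by apply: ler_sum => i _; rewrite ler_wiXn2l// ?ltW// -ltnS.
Qed.

Lemma cabs_le_ReIm z : cabs z <= `|Re z| + `|Im z|.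
Proof.
rewrite cabs_le ?addr_ge0// sqrrD !real_normK ?num_real// /sqn.
have : 0 <= `|Re z| * `|Im z| by rewrite mulr_ge0.
by rewrite mulr2n; lra.
Qed.

Lemma cseries_cvg_dominated u (v : nat -> R) :
  (forall k, cabs (u k) <= v k) -> cvg (series v @ \oo) -> cseries_cvg u.
Proof.
move=> uv cv; have v0 k : 0 <= v k by apply: le_trans (uv k); exact: cabs_ge0.
split; apply: normed_cvg; apply: (series_le_cvg _ _ _ cv) => k //=.
- exact: le_trans (normRe_le _) (uv k).
- exact: le_trans (normIm_le _) (uv k).
Qed.

Lemma csumB u w : cseries_cvg u -> cseries_cvg w ->
  csum (fun k => u k - w k) = csum u - csum w.
Proof.
move=> [ru iu] [rw iw]; rewrite /csum.
have -> : (fun k => Re (u k - w k)) = (fun k => Re (u k)) - (fun k => Re (w k)).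
  by apply/funext => k; rewrite ReB.
have -> : (fun k => Im (u k - w k)) = (fun k => Im (u k)) - (fun k => Im (w k)).
  by apply/funext => k; rewrite ImB.
by rewrite (lim_seriesB ru rw) (lim_seriesB iu iw).
Qed.

Lemma cseries_cvgB u w : cseries_cvg u -> cseries_cvg w ->
  cseries_cvg (fun k => u k - w k).
Proof.
move=> [ru iu] [rw iw]; split.
- rewrite (_ : (fun k => _) = (fun k => Re (u k)) - (fun k => Re (w k))).
    exact: is_cvg_seriesB.
  by apply/funext => k; rewrite ReB.
- rewrite (_ : (fun k => _) = (fun k => Im (u k)) - (fun k => Im (w k))).
    exact: is_cvg_seriesB.
  by apply/funext => k; rewrite ImB.
Qed.

Lemma csum_finite u K : (forall k, (K <= k)%N -> u k = 0) ->
  cseries_cvg u /\ csum u = \sum_(k < K) u k.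
Proof.
move=> uK.
have H (f : nat -> R) : (forall k, (K <= k)%N -> f k = 0) ->
    series f @ \oo --> \sum_(k < K) f k.
  move=> fK; apply: (cvg_near_cst (\sum_(k < K) f k)); exists K => // m /= Km.
  rewrite seriesEnat/= (big_cat_nat (n := K))//= [X in _ + X](_ : _ = 0).
    by rewrite addr0 big_mkord.
  by rewrite big_nat big1// => i /andP[Ki _]; exact: fK.
have Hr := H (fun k => Re (u k)) (fun k Kk => congr1 Re (uK k Kk)).
have Hi := H (fun k => Im (u k)) (fun k Kk => congr1 Im (uK k Kk)).
split.
  by split; [apply: cvgP Hr|apply: cvgP Hi].
rewrite /csum (cvg_lim _ Hr)// (cvg_lim _ Hi)//.
by apply/eqP; rewrite eq_complex/= Re_sum Im_sum !eqxx.
Qed.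

Definition taylor_poly a N : {poly C} := \poly_(k < N.+1) a k.

Lemma deriv_taylor_poly a N z :
  (taylor_poly a N)^`().[z] = \sum_(k < N) pderiv a k * z ^+ k.
Proof.
have -> : (taylor_poly a N)^`() = \poly_(k < N) pderiv a k.
  apply/polyP => i; rewrite coef_deriv !coef_poly ltnS /pderiv.
  by case: ifP; rewrite ?mul0rn// mulr_natl.
by rewrite horner_poly.
Qed.

Lemma peval_finite a N z : (forall k, (N < k)%N -> a k = 0) ->
  cseries_cvg (fun k => pderiv a k * z ^+ k) /\
  peval (pderiv a) z = (taylor_poly a N)^`().[z].
Proof.
move=> aN; rewrite deriv_taylor_poly; apply: csum_finite => k Nk.
by rewrite /pderiv aN// mulr0 mul0r.
Qed.

(** Convergence at a radius [r] between [rho] and [1] bounds [|a_k| r^k]. The ratio [rho / r] is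
    split as [y * y]: one power [y^k] absorbs the factor [k + 1] of the derivative, the other
    provides the decay. *)
Lemma holo_deriv_bound a (rho : R) : holo_disk a -> 0 <= rho -> rho < 1 ->
  exists K y : R, [/\ 0 <= K, 0 <= y, y < 1 &
    forall k, cabs (pderiv a k) * rho ^+ k <= K * y ^+ k].
Proof.
move=> ha rho0 rho1.
pose r := (1 + rho) / 2.
have r0 : 0 < r by rewrite /r; lra.
have r1 : r < 1 by rewrite /r; lra.
have rr : rho < r by rewrite /r; lra.
have /ha[cr ci] : disk (Complex r 0 : C) by rewrite /disk /mkset cabs_real gtr0_norm.
have [M [M0 HM]] : exists M, 0 <= M /\ forall k, cabs (a k) * r ^+ k <= M.
  have bnd (f : nat -> R) : cvg (series f @ \oo) -> exists M, forall k, `|f k| <= M.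
    move=> /cvg_series_cvg_0 f0.
    have /cvg_seq_bounded [M [_ HM]] : cvg (f @ \oo) by apply/cvg_ex; exists 0.
    by exists (M + 1) => k; apply: HM; rewrite ?ltrDl.
  have [M1 H1] := bnd _ cr; have [M2 H2] := bnd _ ci.
  exists (M1 + M2); split.
    by apply: addr_ge0; [apply: le_trans (H1 0%N)|apply: le_trans (H2 0%N)].
  move=> k; have -> : cabs (a k) * r ^+ k = cabs (a k * (Complex r 0) ^+ k).
    by rewrite cabsM cabsX cabs_real gtr0_norm.
  by rewrite (le_trans (cabs_le_ReIm _))// lerD.
pose x := rho / r.
have x0 : 0 <= x by rewrite divr_ge0// ltW.
have x1 : x < 1 by rewrite ltr_pdivrMr// mul1r.
pose y := Num.sqrt x.
have y0 : 0 <= y by exact: sqrtr_ge0.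
have y1 : y < 1 by rewrite -sqrtr1 ltr_sqrt.
have y2 : y ^+ 2 = x by rewrite sqr_sqrtr.
exists (M / r / (1 - y)), y; split => //.
  apply: divr_ge0; last by rewrite subr_ge0 ltW.
  by apply: divr_ge0 => //; exact: ltW.
move=> k; rewrite /pderiv cabsM cabs_natr.
have -> : rho ^+ k = r ^+ k * (y ^+ k * y ^+ k).
  by rewrite -exprMn -expr2 y2 -exprMn /x mulrC divfK// gt_eqF.
have Hk : cabs (a k.+1) * r ^+ k <= M / r.
  by rewrite ler_pdivlMr// -mulrA -exprSr.
have -> : k.+1%:R * cabs (a k.+1) * (r ^+ k * (y ^+ k * y ^+ k)) =
  (cabs (a k.+1) * r ^+ k) * (k.+1%:R * y ^+ k) * y ^+ k by ring.
rewrite ler_wpM2r ?exprn_ge0//; apply: ler_pM => //.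
- by rewrite mulr_ge0 ?cabs_ge0// exprn_ge0// ltW.
- by rewrite mulr_ge0 ?exprn_ge0.
- exact: succ_expr_le.
Qed.

Lemma holo_deriv_cvg a z : holo_disk a -> disk z ->
  cseries_cvg (fun k => pderiv a k * z ^+ k).
Proof.
move=> ha z1.
have [K [y [K0 y0 y1 Hk]]] := holo_deriv_bound ha (cabs_ge0 z) z1.
apply: (@cseries_cvg_dominated _ (geometric K y)).
  by move=> k; rewrite cabsM cabsX.
by apply: is_cvg_geometric_series; rewrite ger0_norm.
Qed.

(** The bound is uniform in [N]; it supplies the dominating function in [trunc_fejer_le]. *)
Lemma deriv_taylor_poly_bounded a (rho : R) : holo_disk a -> 0 <= rho -> rho < 1 ->
  exists M : R, forall N z, cabs z <= rho -> sqn (taylor_poly a N)^`().[z] <= M.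
Proof.
move=> ha rho0 rho1.
have [K [y [K0 y0 y1 Hk]]] := holo_deriv_bound ha rho0 rho1.
have Ky0 : 0 <= K / (1 - y) by rewrite divr_ge0// subr_ge0 ltW.
exists ((K / (1 - y)) ^+ 2) => N z zr.
rewrite -cabs_le// deriv_taylor_poly (le_trans (cabs_sum _ _ _))//.
apply: (@le_trans _ _ (\sum_(k < N) K * y ^+ k)).
  apply: ler_sum => k _; apply: le_trans (Hk k); rewrite cabsM cabsX.
  by rewrite ler_wpM2l ?cabs_ge0// lerXn2r// nnegrE cabs_ge0.
by rewrite -mulr_sumr ler_wpM2l// geometric_sum_le.
Qed.

Lemma deriv_taylor_poly_cvg a z : holo_disk a -> disk z ->
  (Re (taylor_poly a N)^`().[z] @[N --> \oo] --> Re (peval (pderiv a) z)) /\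
  (Im (taylor_poly a N)^`().[z] @[N --> \oo] --> Im (peval (pderiv a) z)).
Proof.
move=> ha z1; have [cr ci] := holo_deriv_cvg ha z1.
split.
- have -> : (fun N => Re (taylor_poly a N)^`().[z]) =
     series (fun k => Re (pderiv a k * z ^+ k)).
    by apply/funext => N; rewrite deriv_taylor_poly Re_sum seriesEnat/= big_mkord.
  exact: cr.
- have -> : (fun N => Im (taylor_poly a N)^`().[z]) =
     series (fun k => Im (pderiv a k * z ^+ k)).
    by apply/funext => N; rewrite deriv_taylor_poly Im_sum seriesEnat/= big_mkord.
  exact: ci.
Qed.

Lemma sigmaE n a k :
  sigma_ n a k = if (k <= n)%N then (n.+1 - k)%:R / n.+1%:R * a k else 0.
Proof.
rewrite /sigma_ /s_.
have -> m : \sum_(j < m) (if (k <= j)%N then a k else 0) = a k *+ (m - k).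
  elim: m => [|m IH]; first by rewrite big_ord0 sub0n mulr0n.
  rewrite big_ord_recr/= IH; case: leqP => km; first by rewrite subSn// mulrSr.
  by rewrite addr0 (eqP (ltnW km : (m - k)%N == 0%N)) (eqP (km : (m.+1 - k)%N == 0%N)).
case: ifPn => kn; first by rewrite -mulr_natl; ring.
by rewrite (eqP (_ : (n.+1 - k)%N == 0%N)) ?mulr0n ?mulr0// subn_eq0 ltnNge.
Qed.

(** The freedom in [N] lets the polynomial contraction be applied to ever longer Taylor polynomials
    while its left side stays fixed. *)
Lemma taylor_poly_sigma n a N : (n <= N)%N ->
  taylor_poly (sigma_ n a) n = fejer_poly n (taylor_poly a N).
Proof.
move=> nN; apply/polyP => k; rewrite !coef_poly ltnS sigmaE.
by case: ifPn => // kn; rewrite kn ltnS (leq_trans kn nN).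
Qed.

Lemma peval_sigma n a N z : (n <= N)%N ->
  peval (pderiv (sigma_ n a)) z = (fejer_poly n (taylor_poly a N))^`().[z].
Proof.
move=> nN; rewrite -(taylor_poly_sigma _ nN).
by apply: (proj2 (peval_finite _ _)) => k nk; rewrite sigmaE leqNgt nk.
Qed.

Lemma deriv_sigma_mean n a z :
  peval (pderiv (sigma_ n a)) z =
  n.+1%:R^-1 * \sum_(j < n.+1) (taylor_poly a j)^`().[z].
Proof.
rewrite (peval_sigma _ _ (leqnn n)) -(taylor_poly_sigma _ (leqnn n)).
suff -> : taylor_poly (sigma_ n a) n =
    n.+1%:R^-1 *: \sum_(j < n.+1) taylor_poly a j.
  by rewrite derivZ raddf_sum hornerZ horner_sum.
apply/polyP => k; rewrite coefZ coef_sum coef_poly.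
case: ifPn => kn.
  rewrite /sigma_; congr (_ * _); apply: eq_bigr => j _.
  by rewrite /s_ coef_poly ltnS.
rewrite big1 ?mulr0// => j _; rewrite coef_poly ifF//.
by apply/negbTE; apply: contra kn => kj; exact: leq_trans kj (ltn_ord j).
Qed.

(** By [deriv_sigma_mean] the left sides are arithmetic means of the convergent Taylor derivatives,
    so Cesaro's theorem applies. *)
Lemma peval_sigma_cvg a z : holo_disk a -> disk z ->
  (Re (peval (pderiv (sigma_ n a)) z) @[n --> \oo] --> Re (peval (pderiv a) z)) /\
  (Im (peval (pderiv (sigma_ n a)) z) @[n --> \oo] --> Im (peval (pderiv a) z)).
Proof.
move=> ha z1; have [cr ci] := deriv_taylor_poly_cvg ha z1.
have ReZ (k : nat) (w : C) : Re (k%:R^-1 * w) = k%:R^-1 * Re w /\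
                             Im (k%:R^-1 * w) = k%:R^-1 * Im w.
  have -> : (k%:R^-1 : C) = Complex (k%:R^-1) 0.
    by rewrite natrC -[Complex _ 0]/(k%:R%:C%C) -fmorphV.
  by case: w => x y /=; rewrite !mul0r subr0 addr0.
split.
- rewrite [X in X @ _ --> _](_ : _ =
      arithmetic_mean (fun j => Re (taylor_poly a j)^`().[z])); first exact: cesaro.
  apply/funext => n; rewrite deriv_sigma_mean (ReZ _ _).1 Re_sum /arithmetic_mean/=.
  by rewrite seriesEnat/= big_mkord.
- rewrite [X in X @ _ --> _](_ : _ =
      arithmetic_mean (fun j => Im (taylor_poly a j)^`().[z])); first exact: cesaro.
  apply/funext => n; rewrite deriv_sigma_mean (ReZ _ _).2 Im_sum /arithmetic_mean/=.
  by rewrite seriesEnat/= big_mkord.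
Qed.

Lemma peval_csub b a z : cseries_cvg (fun k => pderiv b k * z ^+ k) ->
  cseries_cvg (fun k => pderiv a k * z ^+ k) ->
  peval (pderiv (csub b a)) z = peval (pderiv b) z - peval (pderiv a) z.
Proof.
move=> cb ca; rewrite /peval -csumB//; congr csum; apply/funext => k.
by rewrite /pderiv /csub; ring.
Qed.

Lemma holo_csub b a : holo_disk b -> holo_disk a -> holo_disk (csub b a).
Proof.
move=> hb ha z dz; have := cseries_cvgB (hb z dz) (ha z dz).
by congr cseries_cvg; apply/funext => k; rewrite /csub mulrBl.
Qed.

Lemma holo_finite a K : (forall k, (K <= k)%N -> a k = 0) -> holo_disk a.
Proof.
by move=> aK z _; apply: (proj1 (@csum_finite _ K _)) => k /aK ->; rewrite mul0r.
Qed.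

Lemma peval0 a : peval a 0 = a 0%N.
Proof.
have [] := @csum_finite (fun k => a k * 0 ^+ k) 1.
  by case=> // k _; rewrite exprS mul0r mulr0.
by move=> _; rewrite /peval => ->; rewrite big_ord1 expr0 mulr1.
Qed.

Lemma sigma0 n a : sigma_ n a 0%N = a 0%N.
Proof. by rewrite sigmaE subn0 divff ?mul1r// pnatr_eq0. Qed.

End PowerSeries.

(** * Superharmonic weights: measurability and truncation *)

Section SuperharmonicWeights.
Variable R : realType.
Local Notation C := (R[i]).
Local Notation Re := (@complex.Re R).
Local Notation Im := (@complex.Im R).
Local Notation mu := (@lebesgue_measure R).
Local Notation plane := (measurableTypeR R * measurableTypeR R)%type.
Local Notation mu2 := (mu \x mu)%E.

Lemma disk_odisk (w : plane) : disk (cplx w) <-> odisk 1 w.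
Proof. by rewrite /disk /odisk /mkset cabs_lt. Qed.

Lemma cabs_box (d : R) (p q : plane) :
  `|q.1 - p.1 : R| < d / 2 -> `|q.2 - p.2 : R| < d / 2 ->
  cabs (cplx q - cplx p) < d.
Proof.
move=> h1 h2; apply: le_lt_trans (cabs_le_ReIm _) _.
rewrite /cplx /=; lra.
Qed.

(** Lower semicontinuity makes the superlevel sets within the disk open in the plane, and these
    generate measurability. *)
Lemma measurable_lsc (f : C -> \bar R) :
  (forall z, disk z -> forall c : R, (c%:E < f z)%E ->
     exists2 d : R, 0 < d & forall w, disk w -> cabs (w - z) < d -> (c%:E < f w)%E) ->
  measurable_fun (odisk 1) (fun w : plane => f (cplx w)).
Proof.
move=> lsc mD; apply: (measurability _ (ErealGenOInfty.measurableE R)) => //.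
move=> _ [_ [c ->] <-]; apply: measurable_open_plane => p [].
move=> /disk_odisk dp; rewrite /= in_itv/= andbT => cp.
have [d d0 Hd] := lsc _ dp _ cp.
pose e := Num.min d (1 - cabs (cplx p)).
have e0 : 0 < e by rewrite lt_min d0 subr_gt0.
exists (e / 2); first by rewrite divr_gt0.
move=> q q1 q2; have qp := cabs_box q1 q2.
have dq : disk (cplx q).
  rewrite /disk /mkset -[cplx q](subrK (cplx p)).
  apply: le_lt_trans (cabsD _ _) _; rewrite -ltrBrDr.
  by apply: lt_le_trans qp _; rewrite ge_min lexx orbT.
split; first exact/disk_odisk.
rewrite /= in_itv/= andbT; apply: Hd => //.
by apply: lt_le_trans qp _; rewrite ge_min lexx.
Qed.

Lemma odisk_circ w (r t : R) : 0 < r -> cabs (cplx w) + r < 1 -> odisk 1 (circ w r t).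
Proof.
move=> r0 wr; apply/disk_odisk; rewrite /disk /mkset cplx_circ.
apply: le_lt_trans (cabsD _ _) _; apply: le_lt_trans wr; rewrite lerD2l.
have -> : Complex (r * cos t) (r * sin t) = Complex r 0 * cis t.
  by apply/eqP; rewrite eq_complex/=; apply/andP; split; apply/eqP; ring.
by rewrite cabsM cabs_cis mulr1 cabs_real gtr0_norm.
Qed.

Lemma measurable_circle (f : C -> \bar R) w (r : R) :
  measurable_fun (odisk 1) (fun w : plane => f (cplx w)) ->
  0 < r -> cabs (cplx w) + r < 1 ->
  measurable_fun (@period R) (fun t : measurableTypeR R => f (cplx (circ w r t))).
Proof.
move=> mf r0 wr; have mr := (measurable_restrictT _ (measurable_odisk 1)).1 mf.
have := measurable_fun_pair2 w (measurableT_comp mr (measurable_circ r)).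
move=> /(measurable_funTS (D := @period R)).
apply: eq_measurable_fun => t _ /=; rewrite patchE mem_set//.
exact: odisk_circ.
Qed.

Variable omega : C -> \bar R.
Hypothesis wo : superharmonic_weight omega.

Lemma weight_ge0 z : disk z -> (0 <= omega z)%E.
Proof. by move=> dz; apply: ltW; exact: wo.2. Qed.

Lemma measurable_weight : measurable_fun (odisk 1) (fun w : plane => omega (cplx w)).
Proof. exact: measurable_lsc wo.1.2.1. Qed.

(** A real function on the whole plane, as [circle_pairing] requires. On the disk the minimum lies
    between [0] and [N], so [fine] loses nothing. *)
Definition trunc_weight (N : nat) (w : plane) : R :=
  fine (((fun w : plane => mine (omega (cplx w)) N%:R%:E) \_ (odisk 1)) w).

Lemma mine_weight_fin N w : odisk 1 w ->
  mine (omega (cplx w)) N%:R%:E \is a fin_num.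
Proof.
move=> /disk_odisk dw; rewrite ge0_fin_numE.
  by rewrite gt_min ltry orbT.
by rewrite le_min weight_ge0//= lee_fin ler0n.
Qed.

Lemma trunc_weightE N w : odisk 1 w ->
  (trunc_weight N w)%:E = mine (omega (cplx w)) N%:R%:E.
Proof.
move=> w1; rewrite /trunc_weight patchE mem_set// fineK//.
exact: mine_weight_fin.
Qed.

Lemma trunc_weight_out N w : ~ odisk 1 w -> trunc_weight N w = 0.
Proof. by move=> w1; rewrite /trunc_weight patchE memNset. Qed.

Lemma trunc_weight_ge0 N w : 0 <= trunc_weight N w.
Proof.
have [w1|w1] := pselect (odisk 1 w); last by rewrite trunc_weight_out.
rewrite -lee_fin trunc_weightE// le_min lee_fin ler0n andbT.
by apply: weight_ge0; exact/disk_odisk.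
Qed.

Lemma trunc_weight_le N w : trunc_weight N w <= N%:R.
Proof.
have [w1|w1] := pselect (odisk 1 w); last by rewrite trunc_weight_out.
by rewrite -lee_fin trunc_weightE// ge_min lexx orbT.
Qed.

Lemma measurable_trunc_weight N : measurable_fun setT (trunc_weight N).
Proof.
apply: (measurableT_comp (fine_measurable measurableT)).
apply/(measurable_restrictT _ (measurable_odisk 1)).
by apply: measurable_mine; [exact: measurable_weight|exact: measurable_cst].
Qed.

(** The mean of a minimum is at most the minimum of the means. *)
Lemma trunc_weight_mean N (w : plane) (r : R) : 0 < r -> cabs (cplx w) + r < 1 ->
  (\int[mu]_(t in @period R) (trunc_weight N (circ w r t))%:E <=
    (2 * pi * trunc_weight N w)%:E)%E.
Proof.
move=> r0 wr.
have pi20 : 0 < 2 * pi :> R by rewrite mulr_gt0// pi_gt0.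
have w1 : odisk 1 w by apply/disk_odisk; rewrite /disk /mkset; lra.
have mT : measurable_fun (@period R) (fun t : measurableTypeR R => (trunc_weight N (circ w r t))%:E).
  apply: measurable_funTS; apply/measurable_EFinP.
  exact: (measurable_fun_pair2 w
    (measurableT_comp (measurable_trunc_weight N) (measurable_circ r))).
have mW := measurable_circle measurable_weight r0 wr.
rewrite EFinM trunc_weightE// mine_pMr//; last by rewrite lee_fin ltW.
rewrite le_min; apply/andP; split.
  have := wo.1.2.2.2 (cplx w) r r0 wr; rewrite /circle_mean.
  rewrite -/(@period R) => H.
  apply: (@le_trans _ _ (\int[mu]_(t in @period R) omega (cplx (circ w r t)))%E).
    apply: ge0_le_integral => //.
    - exact: measurable_period.
    - by move=> t _; rewrite lee_fin trunc_weight_ge0.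
    - move=> t _; rewrite trunc_weightE; last exact: odisk_circ.
      by rewrite ge_min lexx.
  have := lee_wpmul2l (ltW (pi20 : (0 < (2 * pi)%:E)%E)) H.
  rewrite muleA -EFinM divff ?gt_eqF// mul1e.
  exact.
apply: (@le_trans _ _ (\int[mu]_(t in @period R) cst N%:R%:E t)%E).
  apply: ge0_le_integral => //.
  - exact: measurable_period.
  - by move=> t _; rewrite lee_fin trunc_weight_ge0.
  - by move=> t _; rewrite lee_fin trunc_weight_le.
rewrite integral_cst; last exact: measurable_period.
by rewrite [X in (_ * X)%E]lebesgue_period muleC.
Qed.

Lemma trunc_weight_nd w (m n : nat) : (m <= n)%N -> trunc_weight m w <= trunc_weight n w.
Proof.
move=> mn; have [w1|w1] := pselect (odisk 1 w); last by rewrite !trunc_weight_out.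
rewrite -lee_fin !trunc_weightE// le_min ge_min lexx/= ge_min.
by rewrite lee_fin ler_nat mn orbT.
Qed.

Lemma trunc_weight_cvg w : odisk 1 w ->
  ((trunc_weight n w)%:E @[n --> \oo] --> omega (cplx w))%E.
Proof.
move=> w1; under eq_fun do rewrite trunc_weightE//.
have := @weight_ge0 (cplx w) ((disk_odisk w).2 w1).
case: (omega (cplx w)) => [c|_|//].
  rewrite lee_fin => c0; apply: cvg_near_cst.
  exists (Num.bound c) => // n /= cn; rewrite min_l// lee_fin.
  by rewrite (le_trans (ltW (archi_boundP c0)))// ler_nat.
under eq_fun do rewrite min_r ?leey//.
exact/cvgenyP.
Qed.

End SuperharmonicWeights.

(** * Convergence of the Fejer means *)

Section FejerConvergence.
Variable R : realType.
Local Notation C := (R[i]).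
Local Notation Re := (@complex.Re R).
Local Notation Im := (@complex.Im R).
Local Notation mu := (@lebesgue_measure R).
Local Notation plane := (measurableTypeR R * measurableTypeR R)%type.
Local Notation mu2 := (mu \x mu)%E.

Definition dsqn (a : nat -> C) (w : plane) : R := sqn (peval (pderiv a) (cplx w)).

Definition energy (omega : C -> \bar R) (a : nat -> C) : \bar R :=
  (\int[mu2]_(w in odisk 1) ((dsqn a w)%:E * omega (cplx w)))%E.

Lemma dsqn_ge0 a w : 0 <= dsqn a w.
Proof. exact: sqn_ge0. Qed.

Lemma DintE omega a : Dint omega a = ((pi : R)^-1%:E * energy omega a)%E.
Proof.
rewrite /Dint /area_int /energy; congr (_ * _)%E.
rewrite (_ : [set p : R * R | _] = odisk 1); last first.
  by apply/seteqP; split=> w /=; rewrite inE => /disk_odisk.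
by apply: eq_integral => w _; rewrite sqr_cabs.
Qed.

Lemma measurable_peval (a : nat -> C) : holo_disk a ->
  measurable_fun (odisk 1) (fun w : plane => Re (peval (pderiv a) (cplx w))) /\
  measurable_fun (odisk 1) (fun w : plane => Im (peval (pderiv a) (cplx w))).
Proof.
move=> ha.
have H N := @measurable_Re_Im_horner _ _ _ setT (@cplx R) (taylor_poly a N)^`()
   (@measurable_fun_x R) (@measurable_fun_y R).
split.
- apply: (measurable_fun_cvg (h := fun N (w : plane) => Re (taylor_poly a N)^`().[cplx w])).
    by move=> N; apply: measurable_funTS; exact: (H N).1.
  by move=> w /disk_odisk dw; exact: (deriv_taylor_poly_cvg ha dw).1.
- apply: (measurable_fun_cvg (h := fun N (w : plane) => Im (taylor_poly a N)^`().[cplx w])).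
    by move=> N; apply: measurable_funTS; exact: (H N).2.
  by move=> w /disk_odisk dw; exact: (deriv_taylor_poly_cvg ha dw).2.
Qed.

Lemma measurable_dsqn a : holo_disk a -> measurable_fun (odisk 1) (dsqn a).
Proof. by move=> /measurable_peval[mr mi]; exact: measurable_sqn. Qed.

Lemma cvg_sqn (u : nat -> C) (l : C) : Re (u n) @[n --> \oo] --> Re l ->
  Im (u n) @[n --> \oo] --> Im l -> sqn (u n) @[n --> \oo] --> sqn l.
Proof. by move=> ur ui; rewrite /sqn; under eq_fun do rewrite !expr2; rewrite !expr2; apply: cvgD; apply: cvgM. Qed.

Lemma odiskS (r1 r2 : R) : 0 <= r1 -> r1 <= r2 -> odisk r1 `<=` odisk r2.
Proof.
move=> r10 r12 w /= w1; apply: lt_le_trans w1 _.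
by rewrite lerXn2r// nnegrE (le_trans r10).
Qed.

Section Weight.
Variables (omega : C -> \bar R) (a : nat -> C).
Hypotheses (wo : superharmonic_weight omega) (ha : holo_disk a).

Lemma measurable_density b : measurable_fun (odisk 1) (dsqn b) ->
  measurable_fun (odisk 1) (fun w : plane => (dsqn b w)%:E * omega (cplx w))%E.
Proof.
move=> mb; apply: emeasurable_funM; first exact/measurable_EFinP.
exact: measurable_weight.
Qed.

Lemma density_ge0 b (w : plane) : odisk 1 w -> (0 <= (dsqn b w)%:E * omega (cplx w))%E.
Proof.
move=> w1; rewrite mule_ge0 ?lee_fin ?dsqn_ge0// weight_ge0//.
exact/disk_odisk.
Qed.

(** The polynomial contraction is applied to the Taylor polynomials of order [k >= n]. Its left side
    does not depend on [k], and dominated convergence treats the right side on the compactly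
    contained disk. *)
Lemma trunc_fejer_le n N (rho1 rho : R) : 0 <= rho1 -> rho1 < rho -> rho < 1 ->
  (\int[mu2]_(w in odisk rho1) (dsqn (sigma_ n a) w * trunc_weight omega N w)%:E <=
   \int[mu2]_(w in odisk rho) (dsqn a w * trunc_weight omega N w)%:E)%E.
Proof.
move=> rho10 rho1rho rho_lt1.
have rho0 : 0 <= rho by lra.
have mTW := measurable_trunc_weight wo N.
have [M HM] := deriv_taylor_poly_bounded ha rho0 rho_lt1.
pose f k (w : plane) := (sqn (taylor_poly a k)^`().[cplx w] * trunc_weight omega N w)%:E.
pose f' (w : plane) := (dsqn a w * trunc_weight omega N w)%:E.
have sub : odisk rho `<=` odisk 1 by apply: odiskS => //; exact: ltW.
have mrho := @measurable_odisk R rho.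
have [_ _ cv] : [/\ mu2.-integrable (odisk rho) f',
  [sequence \int[mu2]_(w in odisk rho) `|f k w - f' w| ]_k @ \oo --> 0 &
  [sequence \int[mu2]_(w in odisk rho) f k w]_k @ \oo --> \int[mu2]_(w in odisk rho) f' w]%E.
  apply: (@dominated_convergence _ _ _ mu2 _ mrho f f' (cst (`|M| * N%:R)%:E)).
  - move=> k; apply: measurable_funTS; apply/measurable_EFinP.
    by apply: measurable_funM => //; exact: measurable_sqn_horner.
  - apply/measurable_EFinP; apply: measurable_funM; last exact: measurable_funTS.
    by apply: measurable_funS (measurable_dsqn ha) => //; exact: measurable_odisk.
  - apply: aeW => w /sub w1; apply: cvg_EFin; first by apply: nearW.
    have dw : disk (cplx w) by exact/disk_odisk.
    apply: cvgM; last exact: cvg_cst.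
    by have [cr ci] := deriv_taylor_poly_cvg ha dw; exact: cvg_sqn.
  - apply/integrableP; split; first exact: measurable_cst.
    rewrite (eq_integral (cst (`|M| * N%:R)%:E)); last first.
      by move=> w _ /=; rewrite ger0_norm// mulr_ge0.
    rewrite integral_cst//.
    by rewrite lte_mul_pinfty// (le_lt_trans (odisk_measure_le _ (ltW _)))// ltry.
  - apply: aeW => w k wr; rewrite lee_fin ger0_norm; last first.
      by rewrite mulr_ge0 ?sqn_ge0 ?trunc_weight_ge0.
    apply: ler_pM; rewrite ?sqn_ge0 ?trunc_weight_ge0 ?trunc_weight_le//.
    by apply: le_trans (ler_norm _); apply: HM; rewrite cabs_le// ltW.
apply: cvge_ge cv; exists n => // k /= nk.
rewrite /f.
under eq_integral do rewrite /dsqn (peval_sigma _ _ nk).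
apply: (@fejer_contraction_poly R n _ _ N%:R) => //.
- by move=> w; exact: trunc_weight_ge0.
- by move=> w; exact: trunc_weight_le.
- by move=> w r; exact: trunc_weight_mean.
Qed.

Lemma holo_sigma n : holo_disk (sigma_ n a).
Proof.
by apply: (@holo_finite _ _ n.+1) => k nk; rewrite sigmaE leqNgt nk.
Qed.

(** One index [m] drives both the radii [1 - 1/(m+1)] and the truncation level, so a single monotone
    convergence suffices. The right side uses the next radius because [trunc_fejer_le] needs two
    distinct ones. *)
Lemma fejer_energy_le n : (energy omega (sigma_ n a) <= energy omega a)%E.
Proof.
pose rho (m : nat) : R := 1 - m.+1%:R^-1.
have rho0 m : 0 <= rho m by rewrite subr_ge0 invf_le1// ler1n.
have rho1 m : rho m < 1 by rewrite ltrBlDr ltrDl invr_gt0.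
pose g m := ((fun w : plane => (dsqn (sigma_ n a) w * trunc_weight omega m w)%:E)
   \_ (odisk (rho m))).
have mD := @measurable_odisk R 1.
have subm m : odisk (rho m) `<=` odisk 1 by apply: odiskS => //; exact: ltW.
have ms := measurable_dsqn (holo_sigma n).
have mg m : measurable_fun (odisk 1) (g m).
  apply/measurable_restrict => //; first exact: measurable_odisk.
  rewrite setIidr//; apply/measurable_EFinP; apply: measurable_funM.
    by apply: measurable_funS ms => //; exact: measurable_odisk.
  by apply: measurable_funTS; exact: measurable_trunc_weight.
have g0 m w : odisk 1 w -> (0 <= g m w)%E.
  move=> _; rewrite /g patchE; case: ifP => // _.
  by rewrite lee_fin mulr_ge0 ?dsqn_ge0 ?trunc_weight_ge0.
have ndg w : odisk 1 w -> nondecreasing_seq (g ^~ w).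
  move=> _ m k mk; rewrite /g !patchE; case: ifPn => wm.
    rewrite ifT; last first.
      rewrite inE; apply: (odiskS (rho0 m)); last by rewrite inE in wm; exact: wm.
      by rewrite lerB// lef_pV2 ?posrE// ler_nat.
    by rewrite lee_fin ler_wpM2l ?dsqn_ge0// trunc_weight_nd.
  by case: ifP => // _; rewrite lee_fin mulr_ge0 ?dsqn_ge0 ?trunc_weight_ge0.
have cg w : odisk 1 w -> g ^~ w @ \oo --> ((dsqn (sigma_ n a) w)%:E * omega (cplx w))%E.
  move=> w1.
  have c1 : ((dsqn (sigma_ n a) w * trunc_weight omega m w)%:E @[m --> \oo] -->
      (dsqn (sigma_ n a) w)%:E * omega (cplx w))%E.
    by under eq_fun do rewrite EFinM; apply: cvgeZl => //; exact: trunc_weight_cvg.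
  apply: cvg_trans c1; apply: near_eq_cvg.
  have dw : 0 < 1 - cabs (cplx w) by rewrite subr_gt0; exact/disk_odisk.
  have dwi : 0 <= (1 - cabs (cplx w))^-1 by rewrite invr_ge0 ltW.
  exists (Num.bound (1 - cabs (cplx w))^-1) => // m /= wm.
  rewrite /g patchE ifT// inE /odisk/= -cabs_lt// ltrBrDr addrC -ltrBrDr.
  rewrite invf_plt ?posrE//.
  by apply: lt_le_trans (archi_boundP dwi) _; rewrite ler_nat (leq_trans wm).
rewrite /energy.
have -> : (\int[mu2]_(w in odisk 1) ((dsqn (sigma_ n a) w)%:E * omega (cplx w)) =
   \int[mu2]_(w in odisk 1) limn (g ^~ w))%E.
  by apply: eq_integral => w; rewrite inE => w1; apply/esym/cvg_lim => //; exact: cg.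
rewrite (monotone_convergence _ mD mg g0 ndg).
apply: lime_le.
  apply: ereal_nondecreasing_is_cvgn => m k mk.
  apply: ge0_le_integral => //.
  - by move=> w w1; exact: g0.
  - by move=> w w1; exact: ndg.
apply: nearW => m; rewrite -integral_mkcondr setIidr//.
apply: le_trans (@trunc_fejer_le n m (rho m) (rho m.+1) (rho0 m) _ (rho1 m.+1)) _.
  by rewrite ltrD2l ltrN2 ltf_pV2 ?posrE// ltr_nat.
apply: (@le_trans _ _ (\int[mu2]_(w in odisk (rho m.+1))
   ((dsqn a w)%:E * omega (cplx w)))%E).
  apply: ge0_le_integral => //.
  - exact: measurable_odisk.
  - by move=> w _; rewrite lee_fin mulr_ge0 ?dsqn_ge0 ?trunc_weight_ge0.
  - apply/measurable_EFinP; apply: measurable_funM.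
      by apply: measurable_funS (measurable_dsqn ha) => //; exact: measurable_odisk.
    by apply: measurable_funTS; exact: measurable_trunc_weight.
  - apply: measurable_funS (measurable_density (measurable_dsqn ha)) => //.
  - move=> w /subm w1; rewrite EFinM lee_wpmul2l ?lee_fin ?dsqn_ge0//.
    by rewrite trunc_weightE// ge_min lexx.
apply: ge0_subset_integral => //.
- exact: measurable_odisk.
- exact: measurable_density (measurable_dsqn ha).
- by move=> w; exact: density_ge0.
Qed.

(** The weight may be [+oo], where multiplication is not continuous at [x = 0]; the convention
    [0 * +oo = 0] keeps the inequality true there. *)
Lemma le_limn_einf_mule (x_ : nat -> R) (x : R) (y : \bar R) :
  (forall n, 0 <= x_ n) -> x_ @ \oo --> x -> (0 <= y)%E ->
  (x%:E * y <= limn_einf (fun n => (x_ n)%:E * y))%E.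
Proof.
move=> x0 xx; case: y => [y|_|//].
  move=> _; have c : ((x_ n)%:E * y%:E)%E @[n --> \oo] --> (x%:E * y%:E)%E.
    under eq_fun do rewrite -EFinM; rewrite -EFinM; apply: cvg_EFin; first by apply: nearW.
    by apply: cvgM => //; exact: cvg_cst.
  by rewrite is_cvg_limn_einfE ?(cvg_lim _ c)//; apply: cvgP c.
have xge0 : 0 <= x by apply: (cvgr_to_ge xx); apply: nearW.
move: xge0; rewrite le_eqVlt => /predU1P[<-|xgt0].
  rewrite mul0e limn_einf_lim; apply: lime_ge; first exact: is_cvg_einfs.
  apply: nearW => n; apply: le_ereal_inf_tmp => _ [m /= _ <-].
  by rewrite mule_ge0// lee_fin.
have c : ((x_ n)%:E * +oo)%E @[n --> \oo] --> (+oo : \bar R)%E.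
  apply: cvg_near_cst; have /cvgr_gt/(_ 0 xgt0) := xx.
  by apply: filterS => n xn; rewrite gt0_muley ?lte_fin.
by rewrite is_cvg_limn_einfE ?(cvg_lim _ c) ?leey//; apply: cvgP c.
Qed.

Lemma lt_limn_einf (u : nat -> \bar R) (x : \bar R) : (x < limn_einf u)%E ->
  \forall n \near \oo, (x < u n)%E.
Proof.
rewrite limn_einf_lim (cvg_lim _ (@cvg_einfs_sup _ u))// => /ereal_sup_gt[_ [n _ <-] xn].
exists n => // m /= nm; apply: lt_le_trans xn _.
by apply: ereal_inf_lbound; exists m.
Qed.

(** The companion of [dsqn (csub b c)] in the parallelogram law. *)
Definition psum (b c : nat -> C) (w : plane) : R :=
  sqn (peval (pderiv b) (cplx w) + peval (pderiv c) (cplx w)).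

Lemma fejer_energy_cvg : (energy omega a < +oo)%E ->
  (energy omega (csub (sigma_ n a) a) @[n --> \oo] --> (0 : \bar R))%E.
Proof.
move=> Efin.
have E0 b : (0 <= energy omega b)%E by apply: integral_ge0 => w; exact: density_ge0.
have mD := @measurable_odisk R 1.
have Efn : energy omega a \is a fin_num by rewrite ge0_fin_numE.
pose Ep n := (\int[mu2]_(w in odisk 1) ((psum (sigma_ n a) a w)%:E * omega (cplx w)))%E.
have [mra mia] := measurable_peval ha.
have mp n : measurable_fun (odisk 1) (fun w : plane => (psum (sigma_ n a) a w)%:E * omega (cplx w))%E.
  have [mrs mis] := measurable_peval (holo_sigma n).
  apply: emeasurable_funM; last exact: measurable_weight.
  apply/measurable_EFinP; apply: measurable_sqn.
    by under eq_fun do rewrite ReD; exact: measurable_funD.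
  by under eq_fun do rewrite ImD; exact: measurable_funD.
have dsub n w : odisk 1 w -> dsqn (csub (sigma_ n a) a) w =
    sqn (peval (pderiv (sigma_ n a)) (cplx w) - peval (pderiv a) (cplx w)).
  move=> w1; have dw : disk (cplx w) by exact/disk_odisk.
  by rewrite /dsqn peval_csub//; apply: holo_deriv_cvg => //; exact: holo_sigma.
have mm n : measurable_fun (odisk 1) (fun w : plane =>
    (dsqn (csub (sigma_ n a) a) w)%:E * omega (cplx w))%E.
  apply: measurable_density; apply: measurable_dsqn; apply: holo_csub => //.
  exact: holo_sigma.
have p0 n w : odisk 1 w -> (0 <= (psum (sigma_ n a) a w)%:E * omega (cplx w))%E.
  move=> w1; rewrite mule_ge0 ?lee_fin ?sqn_ge0// weight_ge0//.
  exact/disk_odisk.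
have paral n : (energy omega (csub (sigma_ n a) a) + Ep n <= 4%:E * energy omega a)%E.
  rewrite /energy /Ep -ge0_integralD//;
    try exact: mm; try exact: mp; try exact: p0; try by move=> w; exact: density_ge0.
  have -> : (\int[mu2]_(w in odisk 1) ((dsqn (csub (sigma_ n a) a) w)%:E * omega (cplx w) +
     (psum (sigma_ n a) a w)%:E * omega (cplx w)) =
     \int[mu2]_(w in odisk 1) (2%:E * ((dsqn (sigma_ n a) w)%:E * omega (cplx w)) +
        2%:E * ((dsqn a w)%:E * omega (cplx w))))%E.
    apply: eq_integral => w; rewrite inE => w1.
    have dw := (disk_odisk w).2 w1.
    rewrite dsub// !muleA -!EFinM -!ge0_muleDl ?lee_fin ?mulr_ge0 ?sqn_ge0//.
    by rewrite -!EFinD [in LHS]addrC sqnDB.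
  have md := measurable_density (measurable_dsqn (holo_sigma n)).
  have md' := measurable_density (measurable_dsqn ha).
  rewrite ge0_integralD//; last 4 first.
  - by move=> w w1; rewrite mule_ge0// density_ge0.
  - exact: measurable_funeM.
  - by move=> w w1; rewrite mule_ge0// density_ge0.
  - exact: measurable_funeM.
  rewrite !ge0_integralZl//; try by move=> w; exact: density_ge0.
  rewrite -/(energy omega (sigma_ n a)) -/(energy omega a).
  rewrite (_ : 4%:E = 2%:E + 2%:E :> \bar R)%E; last by rewrite -EFinD; congr EFin; ring.
  rewrite ge0_muleDl; [|by rewrite lee_fin|by rewrite lee_fin].
  apply: leeD2r.
  by apply: lee_wpmul2l; [rewrite lee_fin|exact: fejer_energy_le].
(* Since [sigma_n f + f] tends to [2 f], this term alone uses up the bound of [paral] in the limit,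
   leaving nothing for the difference. *)
have fat : (4%:E * energy omega a <= limn_einf Ep)%E.
  apply: le_trans (fatou mu2 mD mp p0).
  rewrite /energy -ge0_integralZl//; last 2 first.
  - exact: measurable_density (measurable_dsqn ha).
  - by move=> w; exact: density_ge0.
  apply: ge0_le_integral => //.
  - by move=> w w1; rewrite mule_ge0// density_ge0.
  - exact: measurable_funeM (measurable_density (measurable_dsqn ha)).
  - under eq_fun do rewrite limn_einf_lim.
    apply: (emeasurable_fun_cvg (fun n w => einfs (fun n => (psum (sigma_ n a) a w)%:E * omega (cplx w))%E n)).
      by move=> n; exact: measurable_fun_einfs.
    by move=> w _; exact: is_cvg_einfs.
  - move=> w w1; have dw := (disk_odisk w).2 w1.
    rewrite muleA -EFinM; apply: le_limn_einf_mule.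
    + by move=> n; exact: sqn_ge0.
    + have [cr ci] := peval_sigma_cvg ha dw.
      have -> : 4 * dsqn a w = sqn (peval (pderiv a) (cplx w) + peval (pderiv a) (cplx w)).
        by rewrite /dsqn; case: (peval _ _) => x y; rewrite /sqn/=; ring.
      apply: cvg_sqn.
        by under eq_fun do rewrite ReD; rewrite ReD; apply: cvgD => //; exact: cvg_cst.
      by under eq_fun do rewrite ImD; rewrite ImD; apply: cvgD => //; exact: cvg_cst.
    + exact: weight_ge0.
have E4fn : (4%:E * energy omega a)%E \is a fin_num by rewrite fin_numM.
apply/fine_cvgP.
have small (e : R) : 0 < e -> \forall n \near \oo, (energy omega (csub (sigma_ n a) a) < e%:E)%E.
  move=> e0.
  have : ((4%:E * energy omega a - e%:E) < limn_einf Ep)%E.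
    by apply: lt_le_trans fat; rewrite lteBlDr// lteDl// lte_fin.
  move=> /lt_limn_einf; apply: filterS => n Hn.
  rewrite ltNge; apply/negP => Hge.
  have : (4%:E * energy omega a < energy omega (csub (sigma_ n a) a) + Ep n)%E.
    rewrite lteBlDr// in Hn; apply: lt_le_trans Hn _.
    by rewrite addeC leeD2r.
  by rewrite ltNge paral.
split.
  apply: filterS (small 1 ltr01) => n Hn.
  by rewrite (ge0_fin_numE (E0 _)); exact: lt_trans Hn (ltry _).
apply/cvgrPdist_lt => e e0; apply: filterS (small e e0) => n Hn.
have fn : energy omega (csub (sigma_ n a) a) \is a fin_num.
  by rewrite (ge0_fin_numE (E0 _)); exact: lt_trans Hn (ltry _).
rewrite sub0r normrN /= ger0_norm; last exact: fine_ge0 (E0 _).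
by rewrite -lte_fin fineK; [exact: Hn|exact: fn].
Qed.

End Weight.

Lemma fejer_convergence (omega : C -> \bar R) (a : nat -> C) :
  superharmonic_weight omega -> in_Dw omega a ->
  (fun n => Dnorm2 omega (csub (sigma_ n a) a)) @ \oo --> (0 : \bar R).
Proof.
move=> wo [ha fa].
have pi0 : 0 < (pi : R)^-1 by rewrite invr_gt0 pi_gt0.
have E0 b : (0 <= energy omega b)%E.
  by apply: integral_ge0 => w; exact: density_ge0.
have Efin : (energy omega a < +oo)%E.
  move: fa; rewrite DintE; case: (energy omega a) (E0 a) => [r _ _|_|//].
    exact: ltry.
  by rewrite gt0_muley ?ltxx// lte_fin.
have := fejer_energy_cvg wo ha Efin.
move=> /(cvgeZl (y := (pi : R)^-1%:E) isT); rewrite mule0.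
apply: cvg_trans; apply: near_eq_cvg; apply: nearW => n.
rewrite /Dnorm2 peval0 /csub sigma0 subrr cabs0 expr0n/= add0e.
by rewrite -DintE.
Qed.

End FejerConvergence.

(** * The Poisson kernel as a superharmonic weight *)

Section PoissonWeight.
Variable R : realType.
Local Notation C := (R[i]).
Local Notation Re := (@complex.Re R).
Local Notation Im := (@complex.Im R).
Local Notation mu := (@lebesgue_measure R).
Local Notation plane := (measurableTypeR R * measurableTypeR R)%type.
Local Notation mu2 := (mu \x mu)%E.
Implicit Types z w : C.

Definition poisson z : R := (1 - sqn z) / sqn (1 - z).

Lemma disk_sub1 z : disk z -> 0 < cabs (1 - z).
Proof.
rewrite /disk /mkset => z1; have := cabsD (1 - z) z.
by rewrite subrK cabs1; lra.
Qed.

Lemma disk_sub1_neq0 z : disk z -> 1 - z != 0.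
Proof. by move=> /disk_sub1; apply: contraTneq => ->; rewrite cabs0 ltxx. Qed.

Lemma disk_sqn z : disk z -> sqn z < 1.
Proof. by rewrite /disk /mkset cabs_lt// expr1n. Qed.

Lemma sqn_sub1_gt0 z : disk z -> 0 < sqn (1 - z).
Proof. by move=> dz; rewrite -sqr_cabs exprn_gt0// disk_sub1. Qed.

Lemma poisson_gt0 z : disk z -> 0 < poisson z.
Proof. by move=> dz; rewrite divr_gt0 ?sqn_sub1_gt0// subr_gt0 disk_sqn. Qed.

Lemma poissonE z : disk z -> poisson z = 2 * Re (1 - z)^-1 - 1.
Proof.
move=> dz; have := sqn_sub1_gt0 dz; rewrite /poisson.
case: z {dz} => x y; rewrite /sqn/= sub0r => d0; field.
by rewrite gt_eqF.
Qed.

Lemma cabsV z : cabs z^-1 = (cabs z)^-1.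
Proof. exact: Normc.normcV. Qed.

(** The hypothesis forces [|1 - w| >= |1 - z| / 2], so the inverses of [1 - z] and [1 - w] differ by
    at most [2 |w - z| / |1 - z|^2]; the formula [2 Re (1 - z)^-1 - 1] doubles this. *)
Lemma poisson_lip z w : disk z -> disk w -> cabs (w - z) <= cabs (1 - z) / 2 ->
  poisson z - 4 * cabs (w - z) / cabs (1 - z) ^+ 2 <= poisson w.
Proof.
move=> dz dw wz; rewrite !poissonE//.
have zn0 := disk_sub1_neq0 dz; have wn0 := disk_sub1_neq0 dw.
have z0 := disk_sub1 dz; have w0 := disk_sub1 dw.
have w2 : cabs (1 - z) / 2 <= cabs (1 - w).
  have := cabsD (1 - w) (w - z); rewrite addrA subrK; lra.
have E : (1 - z)^-1 - (1 - w)^-1 = (z - w) * ((1 - w)^-1 * (1 - z)^-1).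
  by field; rewrite zn0 wn0.
have : Re (1 - z)^-1 - Re (1 - w)^-1 <= 2 * cabs (w - z) / cabs (1 - z) ^+ 2.
  rewrite -ReB; apply: le_trans (ler_norm _) _; apply: le_trans (normRe_le _) _.
  rewrite E !cabsM !cabsV -cabsN opprB mulrC.
  rewrite [leRHS](_ : _ = (2 / cabs (1 - z)) * (cabs (1 - z))^-1 * cabs (w - z)).
    rewrite ler_wpM2r ?cabs_ge0// ler_wpM2r ?invr_ge0 ?cabs_ge0//.
    by rewrite -[leRHS]invrK invf_div lef_pV2// ?posrE// divr_gt0.
  by field; rewrite gt_eqF.
have -> : 4 * cabs (w - z) / cabs (1 - z) ^+ 2 =
   2 * (2 * cabs (w - z) / cabs (1 - z) ^+ 2) by rewrite !mulrA -natrM.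
lra.
Qed.

Lemma poisson_lsc z : disk z -> forall c : R, (c%:E < (poisson z)%:E)%E ->
  exists2 d : R, 0 < d & forall w, disk w -> cabs (w - z) < d ->
    (c%:E < (poisson w)%:E)%E.
Proof.
move=> dz c; rewrite lte_fin => cz; have z0 := disk_sub1 dz.
exists (Num.min (cabs (1 - z) / 2) ((poisson z - c) * cabs (1 - z) ^+ 2 / 4)).
  by rewrite lt_min !divr_gt0// mulr_gt0 ?subr_gt0// exprn_gt0.
move=> w dw; rewrite lt_min => /andP[w1 w2]; rewrite lte_fin.
apply: lt_le_trans (poisson_lip dz dw (ltW w1)).
rewrite ltrBrDl -ltrBrDr ltr_pdivrMr ?exprn_gt0//.
by rewrite mulrC -ltr_pdivlMr.
Qed.

Lemma measurable_poisson : measurable_fun (odisk 1) (fun w : plane => (poisson (cplx w))%:E).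
Proof. exact: (measurable_lsc poisson_lsc). Qed.

Lemma geometric_poly (b x : C) K : 1 - b * x != 0 ->
  b * (1 - b * x)^-1 = (\poly_(k < K) b ^+ k.+1).[x] +
    b * (b * x) ^+ K * (1 - b * x)^-1.
Proof.
move=> n0; rewrite horner_poly.
have -> : \sum_(i < K) b ^+ i.+1 * x ^+ i = b * \sum_(i < K) (b * x) ^+ i.
  by rewrite mulr_sumr; apply: eq_bigr => i _; rewrite exprS exprMn mulrA.
have := subrX1 (b * x) K; set S := \sum_(i < K) _ => H.
apply: (mulIf n0); rewrite mulrDl !mulfVK//.
have -> : b * S * (1 - b * x) = b * - ((b * x - 1) * S) by ring.
by rewrite -H; ring.
Qed.

(** With [b = (1 - z)^-1], a geometric series in [b x] expands [(1 - (z + x))^-1] on [|x| = r]; its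
    ratio has modulus [q = r / |1 - z| < 1] because [r < 1 - |z|]. The real part of the partial sum
    has mean [Re b], and the tail is uniformly small. *)
Lemma poisson_mean (w : plane) (r : R) : 0 < r -> cabs (cplx w) + r < 1 ->
  (\int[mu]_(t in @period R) (poisson (cplx (circ w r t)))%:E <=
    (2 * pi * poisson (cplx w))%:E)%E.
Proof.
move=> r0 wr; set z := cplx w.
have pi20 : 0 < 2 * pi :> R by rewrite mulr_gt0// pi_gt0.
have dz : disk z by rewrite /disk /mkset -/z in wr *; lra.
have z0 := disk_sub1 dz; have zn0 := disk_sub1_neq0 dz.
have rz : r < cabs (1 - z).
  by have := cabsD (1 - z) z; rewrite subrK cabs1 -/z in wr *; lra.
pose b := (1 - z)^-1.
pose q := r / cabs (1 - z).
have q0 : 0 <= q by rewrite divr_ge0// ltW.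
have q1 : q < 1 by rewrite ltr_pdivrMr// mul1r.
have dc t : disk (cplx (circ w r t)) by apply/disk_odisk; exact: odisk_circ.
apply/lee_addgt0Pr => e e0.
pose e' := e / (2 * pi).
have e'0 : 0 < e' by rewrite divr_gt0.
pose c := 2 * (cabs b * (1 - q)^-1).
have c0 : 0 <= c by rewrite !mulr_ge0 ?cabs_ge0// invr_ge0 subr_ge0 ltW.
have [K HK] : exists K, c * q ^+ K.+1 <= e'.
  have : (fun K => c * q ^+ K) @ \oo --> c * 0.
    by apply: cvgM; [exact: cvg_cst|apply: cvg_expr; rewrite ger0_norm].
  rewrite mulr0 => /cvgr_le/(_ e' e'0)[K _ HK].
  by exists K; apply: HK => /=.
pose p : {poly C} := \poly_(k < K.+1) b ^+ k.+1.
(* The radius [- r] offsets the minus sign built into [has_mean_Re_horner]. *)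
have [ip ep] := has_meanD (has_meanZ 2 (has_mean_Re_horner p 0 (- r)))
   (has_mean_cst (- 1 + c * q ^+ K.+1)).
have dec t : poisson (cplx (circ w r t)) <=
   2 * Re p.[0 - Complex (- r) 0 * cis t] + (- 1 + c * q ^+ K.+1).
  pose x := 0 - Complex (- r) 0 * cis t.
  have cx : cabs x = r.
    by rewrite /x sub0r cabsN cabsM cabs_cis mulr1 cabs_real normrN gtr0_norm.
  have cE : cplx (circ w r t) = z + x.
    rewrite -[r]opprK cplx_circN /x -/z sub0r; congr (_ - _).
  have n1 : 1 - (z + x) != 0 by rewrite -cE; exact: disk_sub1_neq0.
  have bx : 1 - b * x = (1 - (z + x)) / (1 - z).
    by rewrite /b; field.
  have bxn0 : 1 - b * x != 0 by rewrite bx mulf_neq0// invr_eq0.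
  have cbx : cabs (b * x) = q by rewrite cabsM cabsV cx mulrC.
  rewrite poissonE// cE.
  have -> : (1 - (z + x))^-1 = b * (1 - b * x)^-1.
    by rewrite bx /b; field; rewrite zn0 n1.
  rewrite (geometric_poly K.+1 bxn0) ReD -/p -/x.
  have : Re (b * (b * x) ^+ K.+1 / (1 - b * x)) <= cabs b * (1 - q)^-1 * q ^+ K.+1.
    apply: le_trans (ler_norm _) _; apply: le_trans (normRe_le _) _.
    rewrite !cabsM cabsX cbx cabsV mulrAC ler_wpM2r ?exprn_ge0//.
    rewrite ler_wpM2l ?cabs_ge0// lef_pV2 ?posrE ?subr_gt0//.
      by have := cabsD (1 - b * x) (b * x); rewrite subrK cabs1 cbx; lra.
    by have := cabsD (1 - b * x) (b * x); rewrite subrK cabs1 cbx; lra.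
  by rewrite /c; lra.
have p0E : Re p.[0] = Re b by rewrite horner_coef0 coef_poly expr1.
have P0 t : (0 <= (poisson (cplx (circ w r t)))%:E)%E by rewrite lee_fin ltW// poisson_gt0.
apply: (@le_trans _ _ (\int[mu]_(t in @period R)
   (2 * Re p.[0 - Complex (- r) 0 * cis t] + (- 1 + c * q ^+ K.+1))%:E)%E).
  apply: ge0_le_integral => //.
  - exact: measurable_period.
  - exact: (measurable_circle (f := fun z => (poisson z)%:E) measurable_poisson r0 wr).
  - by have /integrableP[] := ip.
  - by move=> t _; rewrite lee_fin.
rewrite ep p0E poissonE// -EFinD lee_fin -/b.
have : 2 * pi * (c * q ^+ K.+1) <= e.
  by rewrite mulrC -ler_pdivlMr.
by lra.
Qed.

Lemma poisson_superharmonic : superharmonic_weight (fun z => (poisson z)%:E).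
Proof.
split; last by move=> z dz; rewrite lte_fin poisson_gt0.
split=> //; split; first exact: poisson_lsc.
split.
  by exists 0; split => //; rewrite /disk /mkset cabs0.
move=> z r r0 zr; rewrite /circle_mean.
have pi20 : 0 < 2 * pi :> R by rewrite mulr_gt0// pi_gt0.
have zE : z = cplx (complex.Re z, complex.Im z) by case: z {zr}.
have := @poisson_mean (complex.Re z, complex.Im z) r r0; rewrite -zE => /(_ zr) H.
have := lee_wpmul2l (_ : 0 <= ((2 * pi)^-1)%:E)%E H.
rewrite lee_fin invr_ge0 (ltW pi20) => /(_ isT).
rewrite -EFinM mulKf ?gt_eqF//; apply: le_trans.
apply: lee_wpmul2l; first by rewrite lee_fin invr_ge0 ltW.
rewrite le_eqVlt; apply/orP; left; apply/eqP.
by apply: eq_integral => t _; rewrite cplx_circ -zE.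
Qed.

End PoissonWeight.

(** * Integrability of the Poisson kernel over the disk *)

Section PoissonIntegral.
Variable R : realType.
Local Notation C := (R[i]).
Local Notation Re := (@complex.Re R).
Local Notation Im := (@complex.Im R).
Local Notation mu := (@lebesgue_measure R).
Local Notation plane := (measurableTypeR R * measurableTypeR R)%type.
Local Notation mu2 := (mu \x mu)%E.

(** [2 atan (y / s)] is an antiderivative. The bound does not depend on [s], so integrating it over
    the other coordinate, with [s = 1 - x], stays finite. *)
Lemma integral_cauchy_kernel (s : R) : 0 < s ->
  (\int[mu]_(y in [set` `[(-1 : R)%R, 1%R]]) (2 * s / (s ^+ 2 + y ^+ 2))%:E <= (2 * pi)%:E)%E.
Proof.
move=> s0.
have d0 (y : R) : 0 < s ^+ 2 + y ^+ 2.
  by rewrite ltr_pwDl ?exprn_gt0// sqr_ge0.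
pose F (y : R) := 2 * atan (s^-1 * y).
pose f (y : R) := 2 * s / (s ^+ 2 + y ^+ 2).
have dF (y : R) : is_derive y 1 F (f y).
  have d1 : is_derive y 1 (fun y : R => s^-1 * y) s^-1.
    by apply: is_derive_eq; rewrite /GRing.scale/= mulr1.
  have d2 : is_derive y 1 (fun y : R => atan (s^-1 * y)) ((1 + (s^-1 * y) ^+ 2)^-1 * s^-1).
    exact: is_derive1_comp.
  apply: is_derive_eq; rewrite /f /GRing.scale/=.
  have dd := d0 y.
  have ss : 0 < s * (s ^+ 2 + y ^+ 2) by rewrite mulr_gt0.
  by field; rewrite !gt_eqF.
have cf : continuous f.
  move=> y; apply: cvgM; first exact: cvg_cst.
  apply: cvgV; first by rewrite gt_eqF.
  apply: cvgD; first exact: cvg_cst.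
  by apply: exprn_continuous.
have at_pi (y : R) : - (pi / 2) < atan y < pi / 2 by rewrite atan_gtNpi2 atan_ltpi2.
rewrite (@continuous_FTC2 _ f F).
- rewrite -EFinB lee_fin /F.
  have /andP[_ h1] := at_pi (s^-1 * 1); have /andP[h2 _] := at_pi (s^-1 * -1).
  by lra.
- by lra.
- exact: continuous_subspaceT.
- split.
  + by move=> t _; case: (dF t).
  + apply: cvg_at_right_filter; apply: differentiable_continuous.
    by apply/derivable1_diffP; case: (dF (-1)).
  + apply: cvg_at_left_filter; apply: differentiable_continuous.
    by apply/derivable1_diffP; case: (dF 1).
- by move=> t _; rewrite derive1E; case: (dF t).
Qed.

(** The denominators agree, and the numerators differ by exactly [|1 - z|^2]. *)
Lemma poisson_kernel_le (x y : R) : odisk 1 ((x, y) : plane) ->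
  poisson (Complex x y) <= 2 * (1 - x) / ((1 - x) ^+ 2 + y ^+ 2).
Proof.
move=> xy; have dz : disk (cplx ((x, y) : plane)) by exact/disk_odisk.
have := sqn_sub1_gt0 dz; rewrite /poisson /cplx /sqn /= sub0r sqrrN => d0.
rewrite ler_pM2r ?invr_gt0//.
have : 0 <= (1 - x) ^+ 2 + y ^+ 2 by exact: ltW.
by rewrite !expr2; lra.
Qed.

Lemma poisson_integral_lty :
  (\int[mu2]_(w in odisk 1) (poisson (cplx w))%:E < +oo)%E.
Proof.
pose I : set (measurableTypeR R) := [set` `[(-1 : R), 1]].
have mI : measurable I by exact: measurable_itv.
have muI : mu I = 2%:E.
  by rewrite /I lebesgue_measure_itv/= lte_fin ifT; [rewrite -EFinB; congr EFin; ring|lra].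
rewrite integral_mkcond.
set g := (_ \_ _).
have mg : measurable_fun setT g.
  by apply/(measurable_restrictT _ (measurable_odisk 1)); exact: measurable_poisson.
have g0 w : (0 <= g w)%E.
  rewrite /g patchE; case: ifPn => //; rewrite inE => /disk_odisk dw.
  by rewrite lee_fin ltW// poisson_gt0.
rewrite fubini_tonelli1//.
have coord (x y : R) : odisk 1 ((x, y) : plane) -> (-1 < x < 1) /\ (-1 < y < 1).
  rewrite /odisk /mkset /sqn/= expr1n => xy.
  have aux (u v : R) : u ^+ 2 + v ^+ 2 < 1 -> -1 < u < 1.
    move=> uv; rewrite -ltr_norml -(@ltr_pXn2r _ 2) ?nnegrE// expr1n real_normK ?num_real//.
    by have := sqr_ge0 v; lra.
  by split; [apply: aux xy|rewrite addrC in xy; apply: aux xy].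
have inner x : (fubini_F mu g x <= (cst (2 * pi)%:E \_ I) x)%E.
  rewrite /fubini_F patchE; case: ifPn => xI; last first.
    rewrite integral0_eq// => y _; rewrite /g patchE; case: ifPn => //.
    rewrite inE => /coord[/andP[x1 x2] _]; exfalso; move/negP: xI; apply.
    by rewrite inE /I/= in_itv/= !ltW.
  have [x1|x1] := ltP (x : R) 1; last first.
    rewrite integral0_eq ?lee_fin ?mulr_ge0 ?pi_ge0// => y _; rewrite /g patchE.
    by case: ifPn => //; rewrite inE => /coord[/andP[_]]; rewrite ltNge x1.
  have s0 : 0 < 1 - (x : R) by rewrite subr_gt0.
  apply: le_trans (integral_cauchy_kernel s0).
  rewrite [leRHS]integral_mkcond; apply: ge0_le_integral => //.
  - exact: (measurable_fun_pair2 x mg).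
  - apply/(measurable_restrictT _ mI); apply/measurable_EFinP.
    apply: measurable_funTS; apply: continuous_measurable_fun => y.
    apply: cvgM; first exact: cvg_cst.
    apply: cvgV; first by rewrite gt_eqF// ltr_pwDl ?exprn_gt0// sqr_ge0.
    by apply: cvgD; [exact: cvg_cst|exact: exprn_continuous].
  - move=> y _; rewrite /g !patchE; case: ifPn => [|_].
      rewrite inE => xy; rewrite ifT.
        by rewrite lee_fin; exact: poisson_kernel_le.
      have [_ /andP[y1 y2]] := coord _ _ xy.
      by rewrite inE /I/= in_itv/= !ltW.
    case: ifP => // _; rewrite lee_fin divr_ge0//.
      by rewrite mulr_ge0// ltW.
    by rewrite addr_ge0 ?sqr_ge0.
apply: (@le_lt_trans _ _ (\int[mu]_x (cst (2 * pi)%:E \_ I) x)%E).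
  apply: ge0_le_integral => //.
  - by move=> x _; exact: integral_ge0.
  - exact: measurable_fun_fubini_tonelli_F.
  - by apply/(measurable_restrictT _ mI); exact: measurable_cst.
rewrite -integral_mkcond integral_cst// [X in (_ * X)%E]muI.
by rewrite -EFinM ltry.
Qed.

End PoissonIntegral.

(** * The lacunary function and the finiteness of its energy *)

Section Lacunary.
Variable R : realType.
Local Notation C := (R[i]).
Local Notation Re := (@complex.Re R).
Local Notation Im := (@complex.Im R).
Local Notation mu := (@lebesgue_measure R).
Local Notation plane := (measurableTypeR R * measurableTypeR R)%type.
Local Notation mu2 := (mu \x mu)%E.

(** The coefficients of [g]; the range [j <= k] is enough because [k = 4^j] forces [j <= k]. *)
Definition lac (k : nat) : R := \sum_(j < k.+1) if k == (4 ^ j)%N then 2 ^- j else 0.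

(** The coefficients of [(z - 1) g]. At [k = 0] the predecessor is again [0], which gives the
    correct value [0] because [g] has no constant term. *)
Definition lac_coef (k : nat) : C := Complex (lac k.-1 - lac k) 0.

Lemma lac_ge0 k : 0 <= lac k.
Proof. by apply: sumr_ge0 => j _; case: ifP => // _; rewrite invr_ge0 exprn_ge0. Qed.

Lemma half_sum_le n : \sum_(j < n) 2 ^- j <= 2 :> R.
Proof.
rewrite [leRHS](_ : _ = (1 - 2^-1)^-1); last by field.
rewrite (eq_bigr (fun j : 'I_n => 2^-1 ^+ j)); last by move=> j _; rewrite exprVn.
by apply: geometric_sum_le; lra.
Qed.

Lemma lac_le2 k : lac k <= 2.
Proof.
by apply: le_trans (half_sum_le k.+1); apply: ler_sum => j _; case: ifP.
Qed.

Lemma sum_ord_pick_le (K m : nat) (G : nat -> R) : 0 <= G m ->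
  \sum_(k < K) (if k == m :> nat then G k else 0) <= G m.
Proof.
move=> Gm; have [mK|Km] := ltnP m K.
  rewrite (bigD1 (Ordinal mK))//= eqxx big1 ?addr0// => i im.
  by rewrite ifF//; apply/negbTE.
rewrite big1// => i _; rewrite ifF//; apply/negbTE.
by rewrite neq_ltn (leq_trans (ltn_ord i) Km).
Qed.

(** For nonnegative terms an inequality suffices, and the right side may run over all [j < K]
    without asking whether [4^j < K]. *)
Lemma lac_sum_le (F : nat -> R) K : (forall k, 0 <= F k) ->
  \sum_(k < K) lac k * F k <= \sum_(j < K) 2 ^- j * F (4 ^ j)%N.
Proof.
move=> F0; pose G j k : R := if k == (4 ^ j)%N then 2 ^- j * F k else 0.
have G0 j k : 0 <= G j k.
  by rewrite /G; case: ifP => // _; rewrite mulr_ge0 ?invr_ge0 ?exprn_ge0.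
apply: (@le_trans _ _ (\sum_(k < K) \sum_(j < K) G j k)).
  apply: ler_sum => k _; rewrite /lac mulr_suml.
  rewrite -(big_mkord xpredT (fun j => (if k == (4 ^ j)%N :> nat then 2 ^- j else 0) * F k)).
  rewrite -(big_mkord xpredT (fun j => G j k)) [leRHS](big_cat_nat (n := k.+1))//=.
  rewrite ler_wpDr//; first by apply: sumr_ge0.
  by apply: ler_sum => j _; rewrite /G; case: ifP => // _; rewrite mul0r.
rewrite exchange_big/=; apply: ler_sum => j _.
apply: (@sum_ord_pick_le K (4 ^ j) (fun k => 2 ^- j * F k)).
by rewrite mulr_ge0 ?invr_ge0 ?exprn_ge0.
Qed.

Lemma lac_pow j : lac (4 ^ j) = 2 ^- j.
Proof.
have j4 : (j < (4 ^ j).+1)%N by rewrite ltnS ltnW// ltn_expl.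
rewrite /lac (bigD1 (Ordinal j4))//= eqxx big1 ?addr0// => i ij.
rewrite ifF// eqn_exp2l//; apply/negbTE; rewrite eq_sym.
by apply: contra ij => /eqP ij; apply/eqP/val_inj.
Qed.

Lemma lac_pow_pred j : lac (4 ^ j.+1).-1 = 0.
Proof.
rewrite /lac big1// => -[i /= _] _; rewrite ifF//; apply/negbTE/eqP.
rewrite expnS; have : (0 < 4 ^ j)%N by rewrite expn_gt0.
case: i => [|i]; first by rewrite expn0; lia.
by rewrite expnS; lia.
Qed.

(** The sum majorizes [|g'|] at radius [r]. Each term times [s] is at most [2^j s] and at most its
    inverse; cutting at the first [J] with [2^J s >= 1] leaves two geometric sums, each at most
    [2]. *)
Lemma lac_deriv_sum_le (r s : R) K : 0 <= r -> r < 1 -> 0 < s -> s ^+ 2 = 1 - r ->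
  (\sum_(j < K) 2 ^+ j * r ^+ (4 ^ j).-1) * s <= 4.
Proof.
move=> r0 r1 s0 s2.
have s1 : s <= 1 by rewrite -(@ler_pXn2r _ 2) ?nnegrE ?(ltW s0)// expr1n s2; lra.
pose h j := 2 ^+ j * r ^+ (4 ^ j).-1 * s.
have h0 j : 0 <= h j by rewrite !mulr_ge0 ?exprn_ge0// ltW.
have h1 j : h j <= 2 ^+ j * s.
  by rewrite ler_wpM2r ?(ltW s0)// ler_piMr ?exprn_ge0// exprn_ile1// ltW.
(* At the exponent [4^j - 1], [succ_expr_le] gives [4^j r^(4^j - 1) <= s^-2]. *)
have h2 j : h j <= (2 ^+ j * s)^-1.
  have := succ_expr_le (4 ^ j).-1 r0 r1.
  rewrite prednK ?expn_gt0// -s2 natrX => H.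
  have c0 : 0 < 2 ^+ j * s :> R by rewrite mulr_gt0 ?exprn_gt0.
  rewrite -[leRHS]mul1r ler_pdivlMr// /h.
  have -> : 2 ^+ j * r ^+ (4 ^ j).-1 * s * (2 ^+ j * s) =
     4 ^+ j * r ^+ (4 ^ j).-1 * s ^+ 2.
    have -> : 4 ^+ j = 2 ^+ j * 2 ^+ j :> R by rewrite -exprMn; congr (_ ^+ _); ring.
    by ring.
  by rewrite -ler_pdivlMr ?exprn_gt0// mul1r.
have exJ : exists J, 1 <= 2 ^+ J * s.
  have /archi_boundP : 0 <= s^-1 by rewrite invr_ge0 ltW.
  set J := Num.bound _ => sJ; exists J.
  rewrite -ler_pdivrMr// mul1r (le_trans (ltW sJ))//.
  by rewrite -natrX ler_nat ltnW// ltn_expl.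
pose J := ex_minn exJ.
have [J1 J2] : 1 <= 2 ^+ J * s /\ 2 ^+ J * s <= 2.
  rewrite /J; case: ex_minnP => -[|m] Hm mmin; split => //.
    by rewrite expr0 mul1r; lra.
  have [Hm'|Hm'] := leP 1 (2 ^+ m * s); first by have := mmin _ Hm'; rewrite ltnn.
  by rewrite exprS -mulrA; lra.
rewrite mulr_suml; apply: (@le_trans _ _ (\sum_(j < J + K) h j)).
  rewrite -!(big_mkord xpredT h) addnC [leRHS](big_cat_nat (n := K))//= ?leq_addr//.
  by rewrite lerDl; apply: sumr_ge0.
rewrite big_split_ord/=.
have A : \sum_(i < J) h i <= 2.
  apply: le_trans J2; apply: (@le_trans _ _ (\sum_(i < J) 2 ^+ i * s)).
    by apply: ler_sum => i _.
  rewrite -mulr_suml ler_pM2r//.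
  by have := subrX1 (2 : R) J; rewrite (_ : 2 - 1 = 1 :> R) ?mul1r; [move=> <-; lra|ring].
have B : \sum_(i < K) h (J + i)%N <= 2.
  apply: le_trans (half_sum_le K); apply: ler_sum => i _; apply: le_trans (h2 _) _.
  rewrite exprD mulrAC invfM ler_piMl ?invr_ge0 ?exprn_ge0//.
  by rewrite invf_le1// (lt_le_trans ltr01 J1).
by lra.
Qed.

(** Truncation of [f' = g - (1 - z) g']; the last term is the boundary term of the summation by
    parts. *)
Lemma pderiv_lacE K z :
  \sum_(k < K) pderiv lac_coef k * z ^+ k =
  \sum_(k < K) Complex (lac k) 0 * z ^+ k -
  (1 - z) * \sum_(k < K) k%:R * Complex (lac k) 0 * z ^+ k.-1 -
  K%:R * Complex (lac K) 0 * z ^+ K.-1.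
Proof.
elim: K => [|K IH]; first by rewrite !big_ord0 !mul0r mulr0 !subr0.
rewrite !big_ord_recr/= IH /pderiv /lac_coef/=.
have -> : Complex (lac K - lac K.+1) 0 = Complex (lac K) 0 - Complex (lac K.+1) 0.
  by apply/eqP; rewrite eq_complex/= subr0 !eqxx.
case: K {IH} => [|K]; first by rewrite !big_ord0/= !expr0; ring.
rewrite /= exprS -[K.+2%:R]natr1 -[K.+1%:R]natr1; ring.
Qed.

(** The three terms bound [g], [(1 - z) g'] and the boundary term of [pderiv_lacE]; the last one
    tends to [0] as [K] grows. *)
Lemma cabs_deriv_lac_le (z : C) (s : R) K : disk z -> 0 < s -> s ^+ 2 = 1 - cabs z ->
  cabs (taylor_poly lac_coef K.+1)^`().[z] <=
  2 + 4 * cabs (1 - z) / s + 2 * (K.+1%:R * cabs z ^+ K).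
Proof.
move=> dz s0 s2; set r := cabs z.
have r0 : 0 <= r by exact: cabs_ge0.
have r1 : r < 1 by exact: dz.
have cl k : cabs (Complex (lac k) 0) = lac k by rewrite cabs_real ger0_norm// lac_ge0.
rewrite deriv_taylor_poly pderiv_lacE.
apply: le_trans (cabsB _ _) _; apply: lerD; last first.
  rewrite !cabsM cabs_natr cl cabsX -/r/= mulrAC mulrC ler_wpM2r ?lac_le2//.
  by rewrite mulr_ge0// exprn_ge0.
apply: le_trans (cabsB _ _) _; apply: lerD.
  apply: le_trans (cabs_sum _ _ _) _.
  apply: (@le_trans _ _ (\sum_(k < K.+1) lac k * r ^+ k)).
    by apply: ler_sum => k _; rewrite cabsM cl cabsX.
  apply: le_trans (lac_sum_le _ (fun k => exprn_ge0 k r0)) _.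
  apply: le_trans (half_sum_le K.+1); apply: ler_sum => j _.
  by rewrite ler_piMr ?invr_ge0 ?exprn_ge0// exprn_ile1// ltW.
rewrite cabsM mulrC mulrAC ler_wpM2r ?cabs_ge0// ler_pdivlMr//.
apply: le_trans (lac_deriv_sum_le K.+1 r0 r1 s0 s2).
rewrite ler_wpM2r ?(ltW s0)//; apply: le_trans (cabs_sum _ _ _) _.
apply: (@le_trans _ _ (\sum_(k < K.+1) lac k * (k%:R * r ^+ k.-1))).
  by apply: ler_sum => k _; rewrite !cabsM cabs_natr cl cabsX mulrAC mulrC.
have F0 k : 0 <= k%:R * r ^+ k.-1 by rewrite mulr_ge0// exprn_ge0.
apply: le_trans (lac_sum_le K.+1 F0) _.
apply: ler_sum => j _; rewrite mulrA ler_wpM2r ?exprn_ge0// natrX.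
have -> : 4 ^+ j = 2 ^+ j * 2 ^+ j :> R by rewrite -exprMn; congr (_ ^+ _); ring.
by rewrite mulKf// expf_neq0.
Qed.

Lemma succ_expr_cvg0 (r : R) : 0 <= r -> r < 1 ->
  (k.+1%:R * r ^+ k) @[k --> \oo] --> 0.
Proof.
move=> r0 r1; pose y := Num.sqrt r.
have y0 : 0 <= y by exact: sqrtr_ge0.
have y1 : y < 1 by rewrite -sqrtr1 ltr_sqrt.
have y2 : y ^+ 2 = r by rewrite sqr_sqrtr.
apply: (@squeeze_cvgr _ _ _ _ (fun=> 0) (fun k => (1 - y)^-1 * y ^+ k)).
- apply: nearW => k; rewrite mulr_ge0 ?exprn_ge0//=.
  rewrite -y2 expr2 exprMn mulrA ler_wpM2r ?exprn_ge0//.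
  exact: succ_expr_le.
- exact: cvg_cst.
- rewrite -[X in _ --> X](mulr0 (1 - y)^-1); apply: cvgM; first exact: cvg_cst.
  by apply: cvg_expr; rewrite ger0_norm.
Qed.

Lemma holo_lac : holo_disk lac_coef.
Proof.
move=> z dz; apply: (@cseries_cvg_dominated _ _ (geometric 4 (cabs z))).
  move=> k; rewrite cabsM cabsX ler_wpM2r ?exprn_ge0 ?cabs_ge0//.
  rewrite /lac_coef cabs_real ler_norml.
  have := lac_ge0 k; have := lac_ge0 k.-1; have := lac_le2 k; have := lac_le2 k.-1.
  by move=> *; apply/andP; split; lra.
by apply: is_cvg_geometric_series; rewrite ger0_norm ?cabs_ge0.
Qed.

(** In the limit [|f'| <= 2 + 4 |1 - z| / s], hence [|f'|^2 <= 8 + 32 |1 - z|^2 / (1 - |z|)] by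
    [(a + b)^2 <= 2 a^2 + 2 b^2]. Multiplied by the kernel, the second term is
    [32 (1 + |z|) < 64]. *)
Lemma dsqn_lac_le (w : plane) : odisk 1 w ->
  dsqn lac_coef w * poisson (cplx w) <= 8 * poisson (cplx w) + 64.
Proof.
move=> /disk_odisk dw; set z := cplx w in dw *.
have x0 : 0 < 1 - cabs z by rewrite subr_gt0.
pose s := Num.sqrt (1 - cabs z).
have s0 : 0 < s by rewrite sqrtr_gt0.
have s2 : s ^+ 2 = 1 - cabs z by rewrite sqr_sqrtr// ltW.
pose B := 2 + 4 * cabs (1 - z) / s.
have B0 : 0 <= B by rewrite addr_ge0// divr_ge0 ?mulr_ge0 ?cabs_ge0// ltW.
have dB : dsqn lac_coef w <= B ^+ 2.
  have [cr ci] := deriv_taylor_poly_cvg holo_lac dw.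
  have cq := cvg_sqn cr ci.
  have cq' : sqn (taylor_poly lac_coef K.+1)^`().[z] @[K --> \oo] --> dsqn lac_coef w.
    by have := cq; rewrite -(cvg_shiftS (fun K => sqn (taylor_poly lac_coef K)^`().[z])).
  have ce : (B + 2 * (K.+1%:R * cabs z ^+ K)) ^+ 2 @[K --> \oo] --> B ^+ 2.
    rewrite expr2; under eq_fun do rewrite expr2.
    have c1 : (B + 2 * (K.+1%:R * cabs z ^+ K)) @[K --> \oo] --> B.
      rewrite -[X in _ --> X]addr0 -[X in _ --> _ + X](mulr0 2).
      apply: cvgD; first exact: cvg_cst.
      apply: cvgM; first exact: cvg_cst.
      by apply: succ_expr_cvg0; [exact: cabs_ge0|exact: dw].
    exact: cvgM.
  apply: (ler_cvg_to cq' ce); apply: nearW => K.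
  rewrite -cabs_le; first exact: cabs_deriv_lac_le.
  by rewrite addr_ge0// !mulr_ge0 ?exprn_ge0 ?cabs_ge0.
have P0 := ltW (poisson_gt0 dw).
apply: (@le_trans _ _ (B ^+ 2 * poisson z)); first by rewrite ler_wpM2r.
have B2 : B ^+ 2 <= 8 + 32 * (sqn (1 - z) / s ^+ 2).
  have -> : sqn (1 - z) / s ^+ 2 = (cabs (1 - z) / s) ^+ 2.
    by rewrite expr_div_n sqr_cabs.
  rewrite /B -mulrA; set t := cabs (1 - z) / s.
  by have := sqr_ge0 (2 - 4 * t); rewrite !expr2; lra.
apply: (@le_trans _ _ ((8 + 32 * (sqn (1 - z) / s ^+ 2)) * poisson z)).
  by rewrite ler_wpM2r.
rewrite mulrDl lerD2l.
have -> : 32 * (sqn (1 - z) / s ^+ 2) * poisson z = 32 * (1 + cabs z).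
  have := sqn_sub1_gt0 dw; rewrite s2 /poisson -[sqn z]sqr_cabs => d0.
  by field; rewrite !gt_eqF.
have : cabs z < 1 by exact: dw.
by lra.
Qed.

Lemma lac_in_Dw : in_Dw (fun z => (poisson z)%:E) lac_coef.
Proof.
split; first exact: holo_lac.
have wo := @poisson_superharmonic R.
have mD := @measurable_odisk R 1.
rewrite DintE lte_mul_pinfty ?lee_fin ?invr_ge0 ?pi_ge0//.
have mP := @measurable_poisson R.
have P0 (w : plane) : odisk 1 w -> 0 <= poisson (cplx w).
  by move=> /disk_odisk dw; apply: ltW; exact: poisson_gt0.
apply: (@le_lt_trans _ _ (\int[mu2]_(w in odisk 1)
   (8%:E * (poisson (cplx w))%:E + cst 64%:E w))%E).
  apply: ge0_le_integral => //.
  - by move=> w; exact: (density_ge0 wo).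
  - exact: (measurable_density wo (measurable_dsqn holo_lac)).
  - by apply: emeasurable_funD; [exact: measurable_funeM|exact: measurable_cst].
  - move=> w w1; rewrite -!EFinM -EFinD lee_fin.
    exact: dsqn_lac_le.
rewrite ge0_integralD//; try exact: measurable_funeM;
  try by move=> w w1; rewrite ?mule_ge0 ?lee_fin// P0.
rewrite ge0_integralZl//.
rewrite integral_cst//; apply: lte_add_pinfty.
  by rewrite lte_mul_pinfty ?lee_fin//; exact: poisson_integral_lty.
rewrite lte_mul_pinfty ?lee_fin//.
exact: le_lt_trans (@odisk_measure_le R 1 ler01 (lexx 1)) (ltry _).
Qed.

End Lacunary.

(** * Divergence of the partial sums *)

Section PartialSums.
Variable R : realType.
Local Notation C := (R[i]).
Local Notation Re := (@complex.Re R).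
Local Notation Im := (@complex.Im R).
Local Notation mu := (@lebesgue_measure R).
Local Notation plane := (measurableTypeR R * measurableTypeR R)%type.
Local Notation mu2 := (mu \x mu)%E.
Local Notation lac_coef := (@lac_coef R).
Local Notation P := (fun z : C => (poisson z)%:E).

Lemma bernoulli_le (x : R) m : 0 <= x -> x <= 1 -> 1 - m%:R * x <= (1 - x) ^+ m.
Proof.
move=> x0 x1; elim: m => [|m IH]; first by rewrite mul0r subr0 expr0.
rewrite exprS; apply: (@le_trans _ _ ((1 - x) * (1 - m%:R * x))).
  rewrite -natr1; have : 0 <= m%:R * x * x by rewrite !mulr_ge0.
  by lra.
by rewrite ler_wpM2l// subr_ge0.
Qed.

(** On the box [[1 - 2d, 1 - d] x [0, d]] near the boundary point [1], the kernel is at least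
    [1/(5d)] and [|z|^(2m)] at least [1/2]; the area [d^2] then gives [d/10]. *)
Lemma monomial_energy_ge (m : nat) :
  (((80 * m.+1%:R)^-1)%:E <=
   \int[mu2]_(w in odisk 1) (sqn (cplx w) ^+ m * poisson (cplx w))%:E)%E.
Proof.
(* The factor [8] ensures [4 m d <= 1/2] in Bernoulli's inequality. *)
pose d : R := (8 * m.+1%:R)^-1.
have m1 : 1 <= m.+1%:R :> R by rewrite ler1n.
have d0 : 0 < d by rewrite invr_gt0; lra.
have dm : d * m.+1%:R = 8^-1 by rewrite /d; field; lra.
have d8 : d <= 8^-1 by rewrite -dm ler_peMr// ltW.
pose I : set (measurableTypeR R) := [set` `[(1 - 2 * d : R), 1 - d]].
pose J : set (measurableTypeR R) := [set` `[(0 : R), d]].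
have mI : measurable I by exact: measurable_itv.
have mJ : measurable J by exact: measurable_itv.
have IJ (w : plane) : (I `*` J) w ->
    odisk 1 w /\ (10 * d)^-1 <= sqn (cplx w) ^+ m * poisson (cplx w).
  case: w => x y [/=]; rewrite /I /J/= !in_itv/= => /andP[x1 x2] /andP[y1 y2].
  have yd : y ^+ 2 <= d ^+ 2 by rewrite lerXn2r// nnegrE// ltW.
  have num : d <= 1 - sqn (Complex x y).
    rewrite /sqn/=.
    have : 0 <= (1 - d - x) * (1 + x) by rewrite mulr_ge0; lra.
    have : 0 <= d * (x - (1 - 2 * d)) by rewrite mulr_ge0; lra.
    have : d * d <= d * 8^-1 by rewrite ler_pM2l.
    by move: yd; rewrite !expr2; lra.
  have w1 : odisk 1 ((x, y) : plane) by rewrite /odisk/= expr1n; lra.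
  split => //; have /disk_odisk dw := w1.
  have den : sqn (1 - Complex x y) <= 5 * d ^+ 2.
    rewrite /sqn/= sub0r sqrrN.
    have : (1 - x) ^+ 2 <= (2 * d) ^+ 2 by apply: lerXn2r; rewrite ?nnegrE; lra.
    by move: yd; rewrite exprMn; lra.
  have pw : (5 * d)^-1 <= poisson (Complex x y).
    rewrite /poisson ler_pdivlMr; last exact: sqn_sub1_gt0 dw.
    apply: le_trans num; rewrite ler_pdivrMl; last by lra.
    by rewrite expr2 mulrA in den; rewrite mulrC; lra.
  have sq : 2^-1 <= sqn (Complex x y) ^+ m.
    have : 1 - 4 * d <= sqn (Complex x y).
      rewrite /sqn/=; have : 0 <= (x - (1 - 2 * d)) * (x + (1 - 2 * d)).
        by rewrite mulr_ge0; lra.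
      by have := sqr_ge0 y; have := sqr_ge0 d; rewrite !expr2; lra.
    move=> H; apply: (@le_trans _ _ ((1 - 4 * d) ^+ m)); last first.
      by apply: lerXn2r; rewrite ?nnegrE ?sqn_ge0//; lra.
    apply: le_trans (bernoulli_le m _ _); [|lra|lra].
    have : m%:R * d <= m.+1%:R * d by rewrite ler_pM2r// ler_nat.
    by rewrite [m.+1%:R * d]mulrC dm; lra.
  rewrite [leLHS](_ : _ = 2^-1 * (5 * d)^-1); last by field; lra.
  by rewrite ler_pM// invr_ge0; lra.
have mP : measurable_fun (odisk 1) (fun w : plane => (sqn (cplx w) ^+ m * poisson (cplx w))%:E).
  under eq_fun do rewrite EFinM; apply: emeasurable_funM; last exact: measurable_poisson.
  apply: measurable_funTS; apply/measurable_EFinP; apply: measurable_funX.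
  exact: measurable_sqn_cplx.
have mIJ : measurable (I `*` J) by exact: measurableX.
have sub : I `*` J `<=` odisk 1 by move=> w /IJ[].
apply: (@le_trans _ _ (\int[mu2]_(w in I `*` J) (cst ((10 * d)^-1)%:E) w)%E); last first.
  apply: (@le_trans _ _ (\int[mu2]_(w in I `*` J) (sqn (cplx w) ^+ m * poisson (cplx w))%:E)%E).
    apply: ge0_le_integral => //.
    - by move=> w _; rewrite lee_fin invr_ge0; lra.
    - by apply: measurable_funS mP => //; exact: measurable_odisk.
    - by move=> w /IJ[_]; rewrite lee_fin.
  apply: ge0_subset_integral => //; first exact: measurable_odisk.
  move=> w /disk_odisk dw; rewrite lee_fin mulr_ge0 ?exprn_ge0 ?sqn_ge0//.
  exact/ltW/poisson_gt0.
rewrite integral_cst// [X in (_ * X)%E]product_measure1E//.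
rewrite [X in (_ * (X * _))%E]lebesgue_measure_itv/= [X in (_ * (_ * X))%E]lebesgue_measure_itv/=.
rewrite !lte_fin d0 ifT; last by lra.
rewrite -!EFinB -!EFinM lee_fin.
rewrite [leRHS](_ : _ = d / 10); last by field; lra.
by rewrite /d [leRHS](_ : _ = (80 * m.+1%:R)^-1)//; field; lra.
Qed.

Lemma peval_s_ n (a : nat -> C) z :
  peval (pderiv (s_ n a)) z = \sum_(k < n) pderiv a k * z ^+ k.
Proof.
have aN k : (n < k)%N -> s_ n a k = 0 by rewrite /s_ ltnNge => /negbTE ->.
rewrite (peval_finite z aN).2 deriv_taylor_poly; apply: eq_bigr => k _.
by rewrite /pderiv /s_ ltn_ord.
Qed.

Lemma holo_s_ n (a : nat -> C) : holo_disk (s_ n a).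
Proof. by apply: (@holo_finite _ _ n.+1) => k; rewrite /s_ ltnNge => /negbTE ->. Qed.

(** The monomial is the difference of the derivatives of two consecutive errors [s_(m+1) f - f] and
    [s_m f - f]. *)
Lemma monomial_le_partial_sums m (a : nat -> C) (w : plane) : holo_disk a -> odisk 1 w ->
  sqn (pderiv a m) * sqn (cplx w) ^+ m <=
  2 * dsqn (csub (s_ m.+1 a) a) w + 2 * dsqn (csub (s_ m a) a) w.
Proof.
move=> ha /disk_odisk dw; rewrite /dsqn.
have cf := holo_deriv_cvg ha dw.
have cs k := holo_deriv_cvg (@holo_s_ k a) dw.
rewrite (peval_csub (cs m.+1) cf) (peval_csub (cs m) cf).
rewrite !peval_s_ big_ord_recr/= -sqnX -sqnM.
set S := \sum_(k < m) _; set f := peval _ _; set t := pderiv a m * _.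
have tE : t = (S + t - f) + - (S - f) by ring.
rewrite {1}tE.
by apply: le_trans (sqnD_le _ _) _; rewrite sqnN.
Qed.

(** [g] has coefficient [2^-(j+1)] at [n] and [0] at [n - 1], so [|n a_n|^2 = n]; this cancels the
    factor [1/n] in the lower bound for the energy of [z^(n-1)]. *)
Lemma lac_partial_sums_ge j n : n = (4 ^ j.+1)%N ->
  (80^-1%:E <= 2%:E * energy P (csub (s_ n lac_coef) lac_coef) +
               2%:E * energy P (csub (s_ n.-1 lac_coef) lac_coef))%E.
Proof.
move=> nE; have wo := @poisson_superharmonic R; have hl := @holo_lac R.
have mD := @measurable_odisk R 1.
have n0 : (0 < n)%N by rewrite nE expn_gt0.
have md k : measurable_fun (odisk 1) (fun w : plane =>
    (dsqn (csub (s_ k lac_coef) lac_coef) w)%:E * P (cplx w))%E.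
  apply: (measurable_density wo); apply: measurable_dsqn; apply: holo_csub => //.
  exact: holo_s_.
have cn : sqn (pderiv lac_coef n.-1) = n%:R.
  rewrite /pderiv prednK// sqnM sqn_natr /lac_coef nE lac_pow_pred lac_pow.
  rewrite {1}/sqn/= expr0n/= addr0 sub0r sqrrN natrX.
  have -> : 4 ^+ j.+1 = 2 ^+ j.+1 * 2 ^+ j.+1 :> R by rewrite -exprMn; congr (_ ^+ _); ring.
  by field; rewrite expf_neq0.
have nR : 0 < n%:R :> R by rewrite ltr0n.
apply: (@le_trans _ _ (n%:R%:E * \int[mu2]_(w in odisk 1)
   (sqn (cplx w) ^+ n.-1 * poisson (cplx w))%:E)%E).
  apply: (@le_trans _ _ (n%:R%:E * ((80 * n.-1.+1%:R)^-1)%:E)%E); last first.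
    by apply: lee_wpmul2l; [rewrite lee_fin ltW|exact: monomial_energy_ge].
  by rewrite prednK// -EFinM lee_fin [leRHS](_ : _ = 80^-1)//; field; rewrite gt_eqF.
have mP : measurable_fun (odisk 1) (fun w : plane => (sqn (cplx w) ^+ n.-1 * poisson (cplx w))%:E).
  under eq_fun do rewrite EFinM; apply: emeasurable_funM; last exact: measurable_poisson.
  apply: measurable_funTS; apply/measurable_EFinP; apply: measurable_funX.
  exact: measurable_sqn_cplx.
have P0 (w : plane) : odisk 1 w -> 0 <= poisson (cplx w).
  by move=> /disk_odisk dw; exact/ltW/poisson_gt0.
rewrite -ge0_integralZl//; try by rewrite lee_fin ltW.
  rewrite /energy -!ge0_integralZl//; try by move=> w; exact: (density_ge0 wo).
  rewrite -ge0_integralD//; try exact: measurable_funeM;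
    try by move=> w w1; rewrite mule_ge0 ?(density_ge0 wo).
  apply: ge0_le_integral => //.
  - by move=> w w1; rewrite -EFinM lee_fin mulr_ge0// mulr_ge0 ?P0// exprn_ge0 ?sqn_ge0.
  - exact: measurable_funeM.
  - by apply: emeasurable_funD; exact: measurable_funeM.
  - move=> w w1; rewrite -!EFinM -EFinD lee_fin.
    have := monomial_le_partial_sums n.-1 hl w1; rewrite cn prednK// => H.
    move: (poisson (cplx w)) (P0 _ w1) => x x0.
    by rewrite !mulrA -mulrDl; exact: ler_wpM2r.
by move=> w w1; rewrite lee_fin mulr_ge0 ?P0// exprn_ge0 ?sqn_ge0.
Qed.

Lemma lac_partial_sums_dvg :
  ~ ((fun n => Dnorm2 P (csub (s_ n lac_coef) lac_coef)) @ \oo --> (0 : \bar R)).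
Proof.
move=> /fine_cvgP[fin cv].
have wo := @poisson_superharmonic R.
have pi0 : 0 < pi :> R by exact: pi_gt0.
(* With the factor [1/pi] of the normalized area, both energies fall below [1/400], and
   [2/400 + 2/400 < 1/80]. *)
pose e : R := (400 * pi)^-1.
have e0 : 0 < e by rewrite invr_gt0 mulr_gt0.
pose E n := energy P (csub (s_ n lac_coef) lac_coef).
have [N _ HN] : \forall n \near \oo, (E n < 400^-1%:E)%E.
  have /cvgr_lt/(_ e e0) small := cv.
  near=> n.
  have fn : Dnorm2 P (csub (s_ n lac_coef) lac_coef) \is a fin_num by near: n.
  have : fine (Dnorm2 P (csub (s_ n lac_coef) lac_coef)) < e by near: n.
  rewrite -lte_fin fineK// => H.
  have : ((pi^-1)%:E * E n < e%:E)%E.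
    by apply: le_lt_trans H; rewrite /Dnorm2 DintE leeDr// lee_fin sqr_ge0.
  have -> : e%:E = ((pi^-1)%:E * 400^-1%:E)%E by rewrite -EFinM /e invfM mulrC.
  by rewrite lte_pmul2l// ?lte_fin ?invr_gt0.
(* [n = 4^(N+1)] is so large that [n - 1] also lies past [N]. *)
have NN : (N <= 4 ^ N.+1)%N by rewrite ltnW// (leq_trans _ (ltn_expl _ _))// leqW.
have NN' : (N <= (4 ^ N.+1).-1)%N.
  by rewrite -ltnS prednK ?expn_gt0// (leq_trans _ (ltn_expl _ _)).
have := lac_partial_sums_ge (erefl (4 ^ N.+1)%N); rewrite leNgt => /negP; apply.
have two (x : \bar R) : (x < 400^-1%:E)%E -> (2%:E * x < 200^-1%:E)%E.
  move=> x400; have -> : 200^-1%:E = (2%:E * 400^-1%:E)%E :> \bar R.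
    by rewrite -EFinM; congr EFin; field.
  by rewrite lte_pmul2l// lte_fin.
apply: lt_trans (lteD (two _ (HN _ NN)) (two _ (HN _ NN'))) _.
by rewrite -EFinD lte_fin; lra.
Unshelve. all: by end_near. Qed.

End PartialSums.

Theorem theorem6 (R : realType) :
  (forall (omega : R[i] -> \bar R) (a : nat -> R[i]),
     superharmonic_weight omega -> in_Dw omega a ->
     (fun n => Dnorm2 omega (csub (sigma_ n a) a)) @ \oo --> (0 : \bar R)) /\
  (exists (omega : R[i] -> \bar R) (a : nat -> R[i]),
     superharmonic_weight omega /\ in_Dw omega a /\
     ~ ((fun n => Dnorm2 omega (csub (s_ n a) a)) @ \oo --> (0 : \bar R))).
Proof.
split; first exact: fejer_convergence.
exists (fun z => (poisson z)%:E), (@lac_coef R).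
split; first exact: poisson_superharmonic.
by split; [exact: lac_in_Dw|exact: lac_partial_sums_dvg].
Qed.
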